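(* Let $x,z$ be nonnegative integers with $x\not\equiv z\pmod 2$, let $\mathbf a=(a_1,\dots,a_m)$, $\mathbf b=(b_1,\dots,b_n)$, $\mathbf c=(c_1,\dots,c_k)$ be sequences of nonnegative integers with $m,n,k$ positive even integers, and let $y\ge -1$ be an integer, where $y=-1$ is allowed only when $a<b$. Put $g=\lfloor\frac{x+z}{2}\rfloor$, $g'=\lceil\frac{x+z}{2}\rceil$, $\mu=\max(a,b)$, $\nu=\min(a,b)$. Then \begin{align*} \operatorname{M}(Q^{\nearrow}_{x,y,z}(\mathbf a;\mathbf c;\mathbf b))=&\operatorname{M}(C_{x,2y+z+2\mu+1,z}(c))\\ &\times s\left(a_1,\dots,a_{m-1},a_m+g',c_1,\dots,c_{k-1},c_k+g+b_n,b_{n-1},\dots,b_1\right)\\ &\times s\left(y+b-\nu,a_1,\dots,a_m,g'+c_1,c_2,\dots,c_k,g,b_n,\dots,b_1,y+a-\nu+1\right)\\ &\times\frac{\operatorname{H}(c+g)}{\operatorname{H}(c)\operatorname{H}(g)}\frac{\operatorname{H}(\mu+y+g')}{\operatorname{H}(\mu+c+y+g')}\\ &\times \frac{\operatorname{H}(\mu+y+z)\operatorname{H}(\mu+c+y+z+1)}{\operatorname{H}(o_a+o_b+o_c+z)\operatorname{H}(|a-b|+e_a+e_b+e_c+2y+z+1)}\\ &\times \frac{\operatorname{H}(o_a+o_b+o_c)\operatorname{H}(|a-b|+e_a+e_b+e_c+2y+1)}{\operatorname{H}(\mu+y)\operatorname{H}(\mu+y+1)}. \end{align*}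
   Context: Work on the triangular lattice drawn with horizontal lattice lines. A lozenge is the union of two unit triangles sharing an edge; a (lozenge) tiling of a region is a covering by lozenges without gaps or overlaps; $\operatorname{M}(R)$ denotes the number of tilings of $R$. Vertical distances are measured in rows (the height of a unit triangle); ''the horizontal lattice line at level $t$ above a point $P$'' is the horizontal lattice line $t$ rows above $P$. Lattice hexagons have all angles $120^\circ$ and their side-lengths are listed clockwise starting from the horizontal top side: north, northeast, southeast, south, southwest, northwest. The east vertex is the common vertex of the northeast and southeast sides; the west vertex is the common vertex of the southwest and northwest sides. Hyperfactorial: $\operatorname{H}(n)=0!\,1!\cdots(n-1)!$ for nonnegative integers $n$ ($\operatorname{H}(0)=1$). For a sequence $\mathbf t=(t_1,\dots,t_r)$ of nonnegative integers, $o_t=\sum_{i\text{ odd}}t_i$, $e_t=\sum_{i \text{ even}}t_i$, and $t=t_1+\dots+t_r$; so $a,b,c,o_a,e_a,o_b,\dots$ refer to $\mathbf a,\mathbf b,\mathbf c$. Dented semihexagon: $s(t_1,\dots,t_r)$ is the number of tilings of the region obtained from the trapezoid with horizontal top side of length $e_t$, horizontal bottom side of length $o_t+e_t$, and two slanted sides of length $o_t$, by removing from its bottom side up-pointing triangles of side-lengths $t_1,t_3,t_5,\dots$ from left to right, the first starting at the left end of the bottom side and consecutive removed triangles separated along the bottom side by distances $t_2,t_4,\dots$. (Equivalently, $s(t_1,\dots,t_{2l-1})=s(t_1,\dots,t_{2l})=\frac{1}{\operatorname{H}(t_1+t_3+\dots+t_{2l-1})}\frac{\prod_{1\le i<j\le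 2l-1,\ j-i\text{ odd}}\operatorname{H}(t_i+\dots+t_j)}{\prod_{1\le i<j\le 2l-1,\ j-i\text{ even}}\operatorname{H}(t_i+\dots+t_j)}$.) Cored hexagon: for nonnegative integers $X,Y,Z,p$, $C_{X,Y,Z}(p)$ is obtained from the hexagon $H$ with side-lengths $X,Y+p,Z,X+p,Y,Z+p$ as follows. Let $H_0$ be the hexagon with side-lengths $X,Y,Z,X,Y,Z$ whose south, southwest and northwest sides lie on the lines of the south, southwest and northwest sides of $H$; let $O$ be the center of symmetry of $H_0$. Remove the up-pointing triangle of side $p$ whose left vertex is: $O$ if $X,Y,Z$ all have the same parity; the point $1/2$ unit west of $O$ if $X$ has parity different from $Y$ and $Z$; the point $1/2$ unit from $O$ in the northwest lattice direction if $Y$ has parity different from $X$ and $Z$; the point $1/2$ unit from $O$ in the southwest lattice direction if $Z$ has parity different from $X$ and $Y$. Fern: a string of lattice triangles of side-lengths $t_1,\dots,t_r$ (side $0$ allowed) with alternating orientations, all having a horizontal side on a common horizontal lattice line $\ell$ (up-pointing ones above $\ell$, down-pointing ones below), consecutive triangles meeting at a vertex on $\ell$; it occupies a segment of $\ell$ of length $t_1+\dots+t_r$. Removing a fern means removing the union of its triangles. The region $Q^{\nearrow}_{x,y,z}(\mathbf a;\mathbf c;\mathbf b)$ (for $x\not\equiv z \pmod 2$): with $O=o_a+o_b+o_c$ and $E=e_a+e_b+e_c$, let $H$ be the hexagon with side-lengths $x+E$, $y+z+O+\max(a-b,0)+1$, $y+z+E+\max(b-a,0)$, $x+O$, $y+z+E+\max(a-b,0)+1$,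 $y+z+O+\max(b-a,0)$. Let $\ell$ be the horizontal lattice line $z+O$ rows below the north side of $H$ (equivalently, at level $y+\max(a-b,0)+1$ above the east vertex); $\ell\cap H$ is a segment of length $x+z+a+b+c$ with endpoints on the northwest and northeast sides. Remove from $H$ three ferns along $\ell$: the left fern with side-lengths $a_1,\dots,a_m$ from left to right, $a_1$ up-pointing, starting at the left endpoint of $\ell\cap H$; the right fern with side-lengths $b_1,\dots,b_n$ read from right to left, $b_1$ up-pointing, ending at the right endpoint of $\ell\cap H$; and the middle fern with side-lengths $c_1,\dots,c_k$ from left to right, $c_1$ up-pointing, placed so that the distance along $\ell$ from the right end of the left fern to the left end of the middle fern is $\lceil\frac{x+z}{2}\rceil$ and the distance from the right end of the middle fern to the left end of the right fern is $\lfloor\frac{x+z}{2}\rfloor$. *)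

(* Defs.v *)
From HB Require Import structures.
From mathcomp Require Import all_boot all_order all_algebra finmap.
Set Implicit Arguments.
Unset Strict Implicit.
Unset Printing Implicit Defensive.
Import Order.TTheory GRing.Theory Num.Theory.
Local Open Scope ring_scope.

(* The pair (i, j) is the lattice point i * e1 + j * e2, where e1 is the unit
   step east and e2 the unit step northeast.  The unit step northwest is thus
   (-1, 1), j is the level in rows, and lines of slope +60 (resp. -60) degrees
   are the level sets of i (resp. of i + j). *)
Definition point := (int * int)%type.

(* (i, j, true) is the up-pointing unit triangle with left vertex (i, j);
   (i, j, false) is the down-pointing one sharing its northeast edge. *)
Definition utri := (int * int * bool)%type.

Definition vertices (T : utri) : seq point :=
  let: (i, j, up) := T in
  if up then [:: (i, j); (i + 1, j); (i, j + 1)]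
  else [:: (i + 1, j); (i, j + 1); (i + 1, j + 1)].

Definition share_edge (T T' : utri) : bool :=
  count [in vertices T'] (vertices T) == 2%N.

Definition region := {fset utri}.

Definition is_lozenge (R : region) (L : {set R}) : bool :=
  [exists T : R, exists T' : R,
    (L == [set T; T']) && share_edge (fsval T) (fsval T')].

Definition is_tiling (R : region) (P : {set {set R}}) : bool :=
  partition P [set: R] && [forall L in P, is_lozenge L].

Definition M (R : region) : nat := #|[set P : {set {set R}} | is_tiling P]|.

(* Convex lattice polygons are given by their lattice points; a unit triangle
   lies in such a polygon iff its three vertices do. *)
Definition inside (P : pred point) (T : utri) : bool := all P (vertices T).

Definition remove (R : region) (Ps : seq (pred point)) : region :=
  [fset T in R | ~~ has (fun P => inside P T) Ps]%fset.

(* (P.1, P.2) is the left end of the horizontal side, and t the side-length. *)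
Definition triangle (up : bool) (P : point) (t : nat) : pred point :=
  fun v => if up
    then [&& P.1 <= v.1, P.2 <= v.2 & v.1 + v.2 <= P.1 + P.2 + t%:Z]
    else [&& v.1 <= P.1 + t%:Z, v.2 <= P.2 & P.1 + P.2 <= v.1 + v.2].

(* Finite set of unit triangles containing all those that have their vertices
   in the strip l <= i <= l + w, 0 <= j <= h. *)
Definition box (l : int) (w h : nat) : seq utri :=
  [seq (l + ij.1%:Z, ij.2%:Z, up)
     | ij <- [seq (i, j) | i <- iota 0 w, j <- iota 0 h],
       up <- [:: true; false]].

Definition region_of (P : pred point) (l : int) (w h : nat) : region :=
  [fset T in box l w h | inside P T]%fset.

(* Hexagon with the given side-lengths, with the left end of the south side at
   (0, 0).  The side-lengths are meant to satisfy n + ne = s + sw and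
   ne + se = sw + nw; then the east vertex is (s, se), the west vertex is
   (- sw, sw), and the six conditions below are the half-planes of the
   six sides. *)
Definition hexagon_points (n ne se s sw nw : nat) : pred point :=
  fun v => [&& 0 <= v.2, v.2 <= (ne + se)%N%:Z,
               - sw%:Z <= v.1, v.1 <= s%:Z,
               0 <= v.1 + v.2 & v.1 + v.2 <= (s + se)%N%:Z].

Definition hexagon (n ne se s sw nw : nat) : region :=
  region_of (hexagon_points n ne se s sw nw) (- sw%:Z) (s + sw) (ne + se).

Definition hyperfact (n : nat) : nat := (\prod_(i < n) i`!)%N.

(* Indices of sequences are 0-based in the library and 1-based in the informal
   convention, hence the exchange of parities. *)
Definition osum (t : seq nat) : nat :=
  (\sum_(i < size t | ~~ odd i) nth 0 t i)%N.
Definition esum (t : seq nat) : nat :=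
  (\sum_(i < size t | odd i) nth 0 t i)%N.

Fixpoint dents (p : nat) (t : seq nat) : seq (pred point) :=
  match t with
  | [::] => [::]
  | [:: t1] => [:: triangle true (p%:Z, 0) t1]
  | t1 :: t2 :: t' => triangle true (p%:Z, 0) t1 :: dents (p + t1 + t2) t'
  end.

(* Trapezoid with the left end of its bottom side at (0, 0). *)
Definition trapezoid_points (top height : nat) : pred point :=
  fun v => [&& 0 <= v.2, v.2 <= height%:Z,
               0 <= v.1 & v.1 + v.2 <= (height + top)%N%:Z].

Definition trapezoid (top height : nat) : region :=
  region_of (trapezoid_points top height) 0 (height + top) height.


Definition dented_semihexagon (t : seq nat) : region :=
  remove (trapezoid (esum t) (osum t)) (dents 0 t).

Definition s (t : seq nat) : nat := M (dented_semihexagon t).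

(* In the coordinates of [hexagon], H0 = hexagon X Y Z X Y Z has its south,
   southwest and northwest sides on those of
   hexagon X (Y + p) Z (X + p) Y (Z + p), and the center of H0 is
   ((X - Y) / 2, (Y + Z) / 2).  [core_vertex2] is twice the left vertex of the
   removed triangle; its coordinates are always even. *)
Definition core_vertex2 (X Y Z : nat) : point :=
  let O2 : point := (X%:Z - Y%:Z, Y%:Z + Z%:Z) in
  if (odd X == odd Y) && (odd Y == odd Z) then O2
  else if odd Y == odd Z then (O2.1 - 1, O2.2)
  else if odd X == odd Z then (O2.1 - 1, O2.2 + 1)
  else (O2.1, O2.2 - 1).

Definition core_vertex (X Y Z : nat) : point :=
  (((core_vertex2 X Y Z).1 %/ 2)%Z, ((core_vertex2 X Y Z).2 %/ 2)%Z).

Definition cored_hexagon (X Y Z p : nat) : region :=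
  remove (hexagon X (Y + p) Z (X + p) Y (Z + p))
    [:: triangle true (core_vertex X Y Z) p].

(* Fern read from left to right, with left end P. *)
Fixpoint fern (up : bool) (P : point) (t : seq nat) : seq (pred point) :=
  if t is t1 :: t' then
    triangle up P t1 :: fern (~~ up) (P.1 + t1%:Z, P.2) t'
  else [::].

(* Fern read from right to left, with right end P. *)
Fixpoint fern_rl (up : bool) (P : point) (t : seq nat) : seq (pred point) :=
  if t is t1 :: t' then
    let Q := (P.1 - t1%:Z, P.2) in triangle up Q t1 :: fern_rl (~~ up) Q t'
  else [::].

(* The truncated differences A - B and B - A are max(a - b, 0) and
   max(b - a, 0).  The integer y may be -1, in which case (for a < b) the
   arguments of absz are still nonnegative. *)
Definition Qregion (x : nat) (y : int) (z : nat) (a c b : seq nat) : region :=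
  let A := sumn a in let B := sumn b in
  let O := (osum a + osum b + osum c)%N in
  let E := (esum a + esum b + esum c)%N in
  let north := (x + E)%N in
  let northeast := absz (y + (z + O + (A - B) + 1)%N%:Z) in
  let southeast := absz (y + (z + E + (B - A))%N%:Z) in
  let south := (x + O)%N in
  let southwest := absz (y + (z + E + (A - B) + 1)%N%:Z) in
  let northwest := absz (y + (z + O + (B - A))%N%:Z) in
  let level : int := (northeast + southeast)%N%:Z - (z + O)%N%:Z in
  let left : int := - southwest%:Z in
  let right : int := (south + southeast)%N%:Z - level in
  remove (hexagon north northeast southeast south southwest northwest)
    (fern true (left, level) a
     ++ fern true (left + (A + uphalf (x + z))%N%:Z, level) c
     ++ fern_rl true (right, level) b).

(* Main.v *)
Require Import Defs.
From mathcomp Require Import all_boot all_order all_algebra finmap.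
From mathcomp Require Import zify ring.
Import Order.TTheory GRing.Theory Num.Theory.
Local Open Scope ring_scope.

(** Cut the region along the line of the ferns.  A tiling is determined by the set
    V of the z gap positions where a vertical lozenge crosses the line, together
    with a tiling of each half.  After adding the forced triangles at its ends, each
    half is a trapezoid minus triangles resting on its base, and by Cohn, Larsen and
    Propp it has [vdm P / hyperfact n] tilings, where P is the set of unit positions
    covered by the dents and [vdm] is the product of the pairwise distances.  If U
    and W are the positions covered by the up- and down-pointing dents, then
    M(Q) is a constant times
    [vdm U * vdm W * sum over V of vdm V ^ 2 * prod of |v - y|] over v in V and
    y in U or W, and the sum depends only on the union of U and W, three intervals
    of lengths y + mu, c and y + mu + 1.  The cored hexagon, cut along the base of
    its core, gives the mirror image of the same sum, while the two factors s are
    [vdm U] and [vdm W] up to hyperfactorials, so the sum is eliminated. *)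

Set Implicit Arguments.
Unset Strict Implicit.
Unset Printing Implicit Defensive.

(** Each v in V is a dent of both halves, so its distances to U and to W occur once each; this is
    why U and W enter the sum over V only through their union. The interval lengths come from the
    hexagon: the west and east vertices lie l = y + max(b - a, 0) and r = y + max(a - b, 0) + 1 rows
    below the line, so the lower half is a trapezoid with end dents of sides l and r, and l + a = y
    + mu, b + r = y + mu + 1. The parameter 2(y + mu) + z + 1 of the cored hexagon puts its west
    vertex y + mu + 1 rows above the base of the core and its east vertex y + mu rows below it: the
    same lengths, in reversed order. The trapezoid formula is itself proved here, by peeling off the
    bottom row: its tilings are indexed by interlacing sequences, and [vdm] is summed over these as
    a determinant of binomial coefficients. The type in which tilings live changes with the region,
    so counts are compared by expanding along one triangle and by induction, not by bijections
    between sets of tilings. *)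

(** * Adjacency of unit triangles *)

Lemma int_near0 (u : int) :
  [\/ u = -1, u = 0, u = 1 | u <> -1 /\ u <> 0 /\ u <> 1].
Proof.
have [|h1] := eqVneq u (-1); first by constructor 1.
have [|h2] := eqVneq u 0; first by constructor 2.
have [|h3] := eqVneq u 1; first by constructor 3.
by constructor 4; lia.
Qed.

(** Triangles whose coordinates differ by more than 1 share no edge, so with the second triangle
    written relative to the first only the differences -1, 0, 1 need separate cases. *)
Lemma share_edgeE i j b i' j' b' :
  share_edge (i, j, b) (i', j', b') =
  if b then ~~ b' && [|| (i' == i) && (j' == j), (i' == i - 1) && (j' == j)
                       | (i' == i) && (j' == j - 1)]
  else b' && [|| (i' == i) && (j' == j), (i' == i + 1) && (j' == j)
               | (i' == i) && (j' == j + 1)].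
Proof.
have [u ->] : exists u, i' = i + u by exists (i' - i); lia.
have [v ->] : exists v, j' = j + v by exists (j' - j); lia.
have hu := int_near0 u; have hv := int_near0 v.
case: hu => hu; case: hv => hv; case: b; case: b';
rewrite /share_edge /= !inE !xpair_eqE;
repeat match goal with |- context [@eq_op _ ?a ?b] =>
 first [have -> : (a == b) = true by lia | have -> : (a == b) = false by lia] end;
by [].
Qed.

Lemma share_edge_irr T : share_edge T T = false.
Proof. by case: T => [[i j] b]; rewrite share_edgeE; case: b. Qed.

Lemma share_edge_sym T T' : share_edge T T' = share_edge T' T.
Proof.
by case: T T' => [[i j] b] [[i' j'] b']; rewrite !share_edgeE;
  case: b; case: b'=> //=; lia.
Qed.

(** * Perfect matchings of a finite graph *)

Section Matchings.
Variables (T : finType) (adj : rel T).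
Hypothesis adj_irr : irreflexive adj.
Hypothesis adj_sym : symmetric adj.

(** The vertex set [D] varies inside a fixed type [T], so that pairs can be deleted and induction
    applies without changing types. *)
Definition matchings (D : {set T}) : {set {set {set T}}} :=
  [set P : {set {set T}} | partition P D &&
    [forall L in P, exists x, exists y, (L == [set x; y]) && adj x y]].

Lemma matchings0 : #|matchings set0| = 1%N.
Proof.
rewrite -(cards1 (set0 : {set {set T}})); apply: eq_card => P.
rewrite !inE; apply/andP/eqP => [[pP _]|->].
  by apply/eqP; rewrite -partition_set0.
split; first by rewrite partition_set0.
by apply/forallP => L; rewrite inE.
Qed.

Lemma matching_block (D : {set T}) P t : P \in matchings D -> t \in D ->
  exists2 u, (u \in D) && adj t u & [set t; u] \in P.
Proof.
rewrite inE => /andP[pP /forallP hL] tD.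
have tc : t \in cover P by rewrite (cover_partition pP).
have := hL (pblock P t); rewrite pblock_mem //=.
move=> /existsP[x /existsP[y /andP[/eqP e axy]]].
have := mem_pblock P t; rewrite tc e !inE => /orP[] /eqP ?; subst t.
  exists y; last by rewrite -e pblock_mem.
  rewrite axy andbT -(cover_partition pP); apply/bigcupP.
  by exists (pblock P x); rewrite ?pblock_mem // e !inE eqxx orbT.
exists x; last by rewrite setUC -e pblock_mem.
rewrite adj_sym axy andbT -(cover_partition pP); apply/bigcupP.
by exists (pblock P y); rewrite ?pblock_mem // e !inE eqxx.
Qed.

(** Deleting the block of [t] is, for each possible partner [u], a bijection onto the matchings of
    what remains. *)
Lemma card_matchings_expand (D : {set T}) t : t \in D ->
  #|matchings D| =
  (\sum_(u in D | adj t u) #|matchings (D :\: [set t; u])|)%N.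
Proof.
move=> tD.
rewrite -sum1_card.
(* The weight 1 of [P] is spread over the partners of [t]: one exists by [matching_block], and
   disjointness of blocks makes it unique. *)
rewrite (eq_bigr (fun P : {set {set T}} =>
   \sum_(u in D | adj t u && ([set t; u] \in P)) 1)%N); last first.
  move=> P PM; have [u /andP[uD tu] Pu] := matching_block PM tD.
  rewrite (bigD1 u) ?uD ?tu //= big1 // => v /andP[/andP[vD /andP[tv Pv]] /eqP[]].
  have tP : trivIset P by move: PM; rewrite inE => /andP[/and3P[]].
  have e : [set t; u] = [set t; v].
    rewrite -(def_pblock tP Pu (x := t)) ?(def_pblock tP Pv (x := t)) //;
    by rewrite !inE eqxx.
  have : v \in [set t; u] by rewrite e !inE eqxx orbT.
  rewrite !inE => /orP[] /eqP // vt.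
  by rewrite vt adj_irr in tv.
rewrite (exchange_big_dep (fun u => (u \in D) && adj t u)) /=; last first.
  by move=> P u _ /andP[-> /andP[-> _]].
apply: eq_bigr => u /andP[uD tu]; rewrite sum1dep_card.
have ntu : [set t; u] != set0 by apply/set0Pn; exists t; rewrite !inE eqxx.
have stu : [set t; u] \subset D.
  by apply/subsetP => v; rewrite !inE => /orP[] /eqP ->.
rewrite -(card_in_imset (f := fun P : {set {set T}} => P :\ [set t; u])); last first.
  move=> P Q; rewrite !inE => /andP[_ /and3P[_ _ PP]] /andP[_ /and3P[_ _ PQ]] e.
  by rewrite -(setD1K PP) e setD1K.
apply: eq_card => Q; apply/imsetP/idP => [[P]|].
  rewrite !inE => /andP[/andP[pP /forallP hP] /and3P[_ _ PP]] ->.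
  rewrite partitionD1 //=; apply/forallP => L.
  by rewrite !inE; apply/implyP => /andP[_ LP]; have := hP L; rewrite LP.
rewrite inE => /andP[pQ /forallP hQ].
have tuQ : [set t; u] \notin Q.
  apply/negP => h; have : t \in cover Q.
    by apply/bigcupP; exists [set t; u]; rewrite ?inE ?eqxx.
  by rewrite (cover_partition pQ) !inE eqxx.
exists ([set t; u] |: Q); last first.
  by rewrite setU1K.
rewrite !inE eqxx /= uD tu andbT.
have := partitionU1 pQ ntu; rewrite -setI_eq0 setIDA setIC -setIDA setDv setI0 eqxx.
have -> : [set t; u] :|: D :\: [set t; u] = D.
  by rewrite -[X in X :|: _](setIidPr stu) setID.
move=> /(_ isT) -> /=; rewrite ?andbT; apply/forallP => L; rewrite !inE.
apply/implyP => /orP[/eqP ->|LQ]; last by have := hQ L; rewrite LQ.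
by apply/existsP; exists t; apply/existsP; exists u; rewrite eqxx.
Qed.
End Matchings.

(** Expanding along [t] on one side and along [f t] on the other keeps both counts in step. *)
Lemma card_matchings_inj (T1 T2 : finType) (adj1 : rel T1) (adj2 : rel T2)
    (f : T1 -> T2) (D : {set T1}) :
  irreflexive adj1 -> symmetric adj1 -> irreflexive adj2 -> symmetric adj2 ->
  injective f -> (forall x y, adj2 (f x) (f y) = adj1 x y) ->
  #|matchings adj1 D| = #|matchings adj2 (f @: D)|.
Proof.
move=> i1 s1 i2 s2 injf hf; move: {2}#|D| (leqnn #|D|) => n.
elim: n D => [|n IH] D.
  by rewrite leqn0 cards_eq0 => /eqP ->; rewrite imset0 !matchings0.
have [->|[t tD]] := set_0Vmem D; first by rewrite imset0 !matchings0.
move=> leD; rewrite (card_matchings_expand i1 s1 tD).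
rewrite (card_matchings_expand i2 s2 (imset_f f tD)).
rewrite big_imset_cond /=; last by move=> x y _ _ /injf.
under [RHS]eq_bigl => u do rewrite hf.
apply: eq_bigr => u /andP[uD tu]; rewrite IH.
  have e : f @: (D :\: [set t; u]) = f @: D :\: [set f t; f u].
    apply/setP => w; rewrite !inE; apply/imsetP/andP => [[v]|[nw /imsetP[v vD e]]].
      by rewrite !inE => /andP[nv vD] ->; rewrite !(inj_eq injf) imset_f.
    by exists v => //; rewrite !inE vD andbT; rewrite e !(inj_eq injf) in nw.
  by rewrite e.
apply: leq_trans (_ : #|D :\ t| <= _)%N; last first.
  by rewrite -ltnS (leq_trans _ leD) // [X in (_ < X)%N](cardsD1 t) tD.
by apply: subset_leq_card; apply/subsetP => v; rewrite !inE negb_or -andbA => /and3P[-> _ ->].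
Qed.

(** * Tilings as matchings of the cells of a region *)

Definition cell_adj (R : region) : rel R :=
  fun x y => share_edge (fsval x) (fsval y).

Lemma cell_adj_irr (R : region) : irreflexive (@cell_adj R).
Proof. by move=> x; apply: share_edge_irr. Qed.

Lemma cell_adj_sym (R : region) : symmetric (@cell_adj R).
Proof. by move=> x y; apply: share_edge_sym. Qed.

Lemma M_matchings (R : region) : M R = #|matchings (@cell_adj R) setT|.
Proof. by []. Qed.

(** Moves a count into the cell type of [R'], where it can be compared with counts for other
    subregions of [R']. *)
Lemma M_embed (R R' : region) (f : utri -> utri) : injective f ->
  (forall T T', share_edge (f T) (f T') = share_edge T T') ->
  (forall T, T \in R -> f T \in R') ->
  M R = #|matchings (@cell_adj R') [set x | fsval x \in [fset f T | T in R]%fset]|.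
Proof.
move=> injf hf sub; rewrite M_matchings.
pose F (x : R) : R' := [` sub _ (fsvalP x)]%fset.
have injF : injective F.
  by move=> x y /(congr1 val) /= /injf /val_inj.
rewrite (card_matchings_inj setT (@cell_adj_irr R) (@cell_adj_sym R)
  (@cell_adj_irr R') (@cell_adj_sym R') injF (fun x y => hf _ _)).
congr #|matchings _ _|; apply/setP => x; rewrite !inE.
apply/imsetP/imfsetP => [[y _ ->]|[T TR e]] /=.
  by exists (fsval y) => //; apply: fsvalP.
by exists [` TR]%fset => //; apply: val_inj.
Qed.

Lemma M_iso (R R' : region) (f g : utri -> utri) : cancel f g -> cancel g f ->
  (forall T T', share_edge (f T) (f T') = share_edge T T') ->
  (forall T, (f T \in R') = (T \in R)) -> M R = M R'.
Proof.
move=> fg gf hf hR.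
rewrite (@M_embed R R' f) //; [|exact: can_inj fg|by move=> T; rewrite hR].
rewrite M_matchings; congr #|matchings _ _|; apply/setP => x; rewrite !inE.
apply/imfsetP; exists (g (fsval x)); last by rewrite gf.
by rewrite /= -hR gf; apply: fsvalP.
Qed.

Lemma M_fset0 : M fset0 = 1%N.
Proof.
rewrite M_matchings -(matchings0 (@cell_adj fset0)).
by congr #|matchings _ _|; apply/setP => -[x h]; exfalso; move: h; rewrite inE.
Qed.

Lemma M_expand (R : region) T : T \in R ->
  M R = (\sum_(T' <- R | share_edge T T') M (R `\ T `\ T')%fset)%N.
Proof.
move=> TR; rewrite M_matchings.
rewrite (card_matchings_expand (@cell_adj_irr R) (@cell_adj_sym R) (t := [` TR]%fset)) ?inE //.
rewrite big_seq_fsetE /=; apply: eq_big => [u|u _]; first by rewrite inE.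
rewrite (@M_embed _ R id) //; last by move=> T'; rewrite !inE => /and3P[].
congr #|matchings _ _|; apply/setP => x; rewrite !inE.
by rewrite fsvalP !andbT negb_or andbC -!val_eqE.
Qed.

Definition nbrs (T : utri) : seq utri :=
  let: (i, j, b) := T in
  if b then [:: (i, j, false); (i - 1, j, false); (i, j - 1, false)]
  else [:: (i, j, true); (i + 1, j, true); (i, j + 1, true)].

Lemma share_edge_nbrs T T' : share_edge T T' = (T' \in nbrs T).
Proof.
case: T T' => [[i j] b] [[i' j'] b']; rewrite share_edgeE /nbrs.
by case: b; rewrite !inE !xpair_eqE; case: b'; rewrite ?(andbT, andbF).
Qed.

Lemma uniq_nbrs T : uniq (nbrs T).
Proof.
by case: T => [[i j] []] /=; rewrite !inE !xpair_eqE !andbT; lia.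
Qed.

Lemma M_expand_nbrs (R : region) T : T \in R ->
  M R = (\sum_(T' <- nbrs T | T' \in R) M (R `\ T `\ T')%fset)%N.
Proof.
move=> TR; rewrite (M_expand TR) -big_filter -[RHS]big_filter.
apply/perm_big/uniq_perm; rewrite ?filter_uniq ?fset_uniq ?uniq_nbrs // => T'.
by rewrite !mem_filter share_edge_nbrs andbC.
Qed.

(** * Forced lozenges, and cutting a region in two *)

Lemma exists_min_level (p0 : point) (K : seq point) :
  exists2 p, p \in p0 :: K & forall q, q \in p0 :: K -> p.2 <= q.2.
Proof.
elim: K p0 => [|p1 K IHK] p0.
  by exists p0; rewrite ?inE // => q; rewrite inE => /eqP ->.
have [p pK hp] := IHK p1; have [le0|lt0] := leP p0.2 p.2.
  exists p0 => [|q]; rewrite inE ?eqxx // => /orP[/eqP -> //|/hp].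
  exact: le_trans.
exists p => [|q]; rewrite inE ?pK ?orbT // => /orP[/eqP ->|/hp //].
exact: ltW.
Qed.

(* Every tiling uses the lozenges (i, j, false) + (i, j + 1, true) for (i, j) in K,
   as seen by removing them in the order of increasing level. *)
Lemma M_forced_vertical (R : region) (K : seq point) : uniq K ->
  (forall i j, (i, j) \in K -> (i, j, false) \in R /\ (i, j + 1, true) \in R) ->
  (forall i j, (i, j) \in K -> (i, j, true) \in R -> (i, j - 1) \in K) ->
  (forall i j, (i, j) \in K -> (i + 1, j, true) \in R -> (i + 1, j - 1) \in K) ->
  M R = M [fset T in R | ~~ (let: (i, j, up) := T in
                             if up then (i, j - 1) \in K else (i, j) \in K)]%fset.
Proof.
move: {2}(size K) (leqnn (size K)) => n; elim: n R K => [|n IH] R K.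
  rewrite leqn0 size_eq0 => /eqP -> _ _ _ _; congr M; apply/fsetP => -[[i j] b].
  by rewrite !inE; case: b; rewrite andbT.
case: K => [|p0 K0].
  move=> _ _ _ _ _; congr M; apply/fsetP => -[[i j] b].
  by rewrite !inE; case: b; rewrite andbT.
have := exists_min_level p0 K0.
move: (p0 :: K0) => K [[i j] pK minp] leK uK hK h1 h2.
have [dR uR] := hK _ _ pK.
have n1 : (i, j, true) \notin R.
  by apply/negP => /(h1 _ _ pK)/minp /=; lia.
have n2 : (i + 1, j, true) \notin R.
  by apply/negP => /(h2 _ _ pK)/minp /=; lia.
rewrite (M_expand_nbrs dR) /= !big_cons big_nil (negbTE n1) (negbTE n2) uR addn0.
rewrite (IH _ (rem (i, j) K)).
- congr M; apply/fsetP => -[[i' j'] b]; rewrite !inE /= !mem_rem_uniq // !inE !xpair_eqE.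
  case: b; rewrite ?andbT ?andbF.
    have -> : (j' - 1 == j) = (j' == j + 1) by lia.
    case: ((i' == i) && (j' == j + 1)) / andP => [[/eqP -> /eqP ->]|_] //=.
    by rewrite addrK pK andbF.
  case: ((i' == i) && (j' == j)) / andP => [[/eqP -> /eqP ->]|_] //=.
  by rewrite pK andbF.
- by rewrite size_rem //; case: (K) leK.
- by rewrite rem_uniq.
- move=> i' j'; rewrite mem_rem_uniq // !inE !xpair_eqE => /andP[ne /hK[-> ->]].
  rewrite !andbT !andbF; split=> //; lia.
- move=> i' j'; rewrite !mem_rem_uniq // !inE !xpair_eqE => /andP[ne h] /and3P[nu _ hR].
  rewrite (h1 _ _ h hR) andbT; lia.
- move=> i' j'; rewrite !mem_rem_uniq // !inE !xpair_eqE => /andP[ne h] /and3P[nu _ hR].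
  rewrite (h2 _ _ h hR) andbT; lia.
Qed.

(** [V] records which lozenges straddling the cut a tiling uses. In the induction on the size of
    [A], the left side is expanded along a triangle [T] of [A], and the right side is split by
    whether [V] uses [T]. *)
Lemma M_cut (I : finType) (d u : I -> utri) (A B : region) :
  injective d -> injective u -> [disjoint A & B]%fset ->
  (forall k, share_edge (d k) (u k)) ->
  (forall x y, x \in A -> y \in B -> share_edge x y ->
     exists2 k, x = d k & y = u k) ->
  M (A `|` B)%fset =
  (\sum_(V : {set I} | [forall k in V, (d k \in A) && (u k \in B)])
     M [fset T in A | T \notin [seq d k | k in V]]%fset *
     M [fset T in B | T \notin [seq u k | k in V]]%fset)%N.
Proof.
move=> injd inju; move: {2}(#|` A|) (leqnn #|` A|) => n.
elim: n A B => [|n IH] A B.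
  rewrite leqn0 cardfs_eq0 => /eqP -> _ _ _; rewrite fset0U (big_pred1 set0).
    rewrite -[LHS]mul1n -M_fset0; congr (M _ * M _)%N; apply/fsetP => T.
      by rewrite !inE.
    by rewrite !inE /image_mem enum_set0 andbT.
  move=> V; apply/forallP/eqP => [h|-> k]; last by rewrite inE.
  by apply/setP => k; have := h k; rewrite !inE; case: (k \in V).
have [->|[T TA]] := fset_0Vmem A; first by move=> _; apply: IH; rewrite cardfs0.
move=> leA dAB hdu hAB.
have TB : T \notin B by move/fdisjointP: dAB; apply.
have cardA' : (#|` (A `\ T)%fset| <= n)%N.
  by rewrite -ltnS (leq_trans _ leA) // [X in (_ < X)%N](cardfsD1 T) TA.
rewrite (M_expand_nbrs (T := T)) ?inE ?TA // (bigID (fun T' => T' \in A)) /=.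
rewrite [RHS](bigID (fun V : {set I} => T \notin [seq d k | k in V])) /=.
congr (_ + _)%N.
  (* Partners of [T] inside [A] account for the sets [V] that avoid [T]. *)
  rewrite [RHS](eq_bigr (fun V : {set I} => \sum_(T' <- nbrs T |
      T' \in [fset T in A | T \notin [seq d k | k in V]]%fset)
     M ([fset T in A | T \notin [seq d k | k in V]] `\ T `\ T')%fset *
     M [fset T in B | T \notin [seq u k | k in V]]%fset)%N); last first.
    move=> V /andP[_ hT]; rewrite (M_expand_nbrs (T := T)) ?inE ?TA //.
    by rewrite big_distrl.
  rewrite (exchange_big_dep (fun T' => T' \in A)) /=; last first.
    by move=> V T' _; rewrite !inE => /andP[].
  apply: eq_big => [T'|T' /andP[_ T'A]].
    by rewrite inE andb_orl andbb; case: (T' \in A) => //=; rewrite ?andbF.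
  have T'B : T' \notin B by move/fdisjointP: dAB; apply.
  have -> : ((A `|` B) `\ T `\ T' = (A `\ T `\ T') `|` B)%fset.
    apply/fsetP => x; rewrite !inE; case: eqVneq => [->|_] /=.
      by rewrite (negbTE T'B).
    by case: eqVneq => [->|_] //=; rewrite (negbTE TB).
  rewrite IH //.
  - apply: eq_big => [V|V _].
      apply/forallP/andP => [h|[/andP[/forallP h hT] hT'] k]; last first.
        apply/implyP => kV; have := h k; rewrite kV !inE /= => /andP[dA ->].
        rewrite dA !andbT; apply/andP; split; apply/eqP => e.
          by move: hT'; rewrite !inE -e image_f ?andbF.
        by move: hT; rewrite -e image_f.
      split; first (apply/andP; split).
      + apply/forallP => k; apply/implyP => kV; have := h k; rewrite kV !inE /=.
        by move=> /andP[/and3P[_ _ ->] ->].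
      + apply/imageP => -[k kV e]; have := h k; rewrite kV !inE /= -e eqxx.
        by rewrite andbF.
      + rewrite !inE T'A; apply/imageP => -[k kV e]; have := h k.
        by rewrite kV !inE /= -e eqxx.
    congr (M _ * _)%N; apply/fsetP => x; rewrite !inE.
    by rewrite -!andbA.
  - by apply: leq_trans cardA'; apply: fsubset_leq_card; apply: fsubD1set.
  - by apply/fdisjointP => x; rewrite !inE => /and3P[_ _]; apply/fdisjointP.
  - by move=> x y; rewrite !inE => /and3P[_ _]; apply: hAB.
(* A partner of [T] across the cut must be [u k0] with [d k0 = T]. The sets using [T] are then
   [k0 |: V], where [V] is admissible after removal of both triangles; without such a [k0] both
   sides vanish. *)
case: (pickP (fun k => (d k == T) && (u k \in B))) => [k0 /andP[/eqP dk0 uk0]|hno]; last first.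
  rewrite big_seq_cond big_pred0 ?big_pred0 //.
    move=> V; apply/negP => /andP[/forallP h]; rewrite negbK => /imageP[k kV e].
    have := h k; rewrite kV /= => /andP[_ uB].
    by have := hno k; rewrite -e eqxx uB.
  move=> T'; apply/negP => /andP[]; rewrite -share_edge_nbrs inE => adj /andP[].
  case: (boolP (T' \in A)) => //= _ T'B _.
  have [k e1 e2] := hAB _ _ TA T'B adj.
  by have := hno k; rewrite -e1 eqxx -e2 T'B.
have uA : u k0 \notin A.
  by apply/negP => /(fdisjointP dAB); rewrite uk0.
rewrite big_mkcond (bigD1_seq (u k0)) ?uniq_nbrs -?share_edge_nbrs -?dk0 ?hdu //=.
rewrite inE uk0 uA orbT /= big1_seq ?addn0; last first.
  move=> T' /andP[/eqP neT']; rewrite -share_edge_nbrs inE => adj.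
  case: (boolP (T' \in A)) => //= _; case: (boolP (T' \in B)) => //= T'B.
  rewrite dk0 in adj; have [k e1 e2] := hAB _ _ TA T'B adj.
  by case: neT'; rewrite e2; congr u; apply: injd; rewrite -e1.
have -> : ((A `|` B) `\ d k0 `\ u k0 = (A `\ T) `|` (B `\ u k0))%fset.
  apply/fsetP => x; rewrite !inE dk0; case: eqVneq => [->|_] /=.
    by rewrite (negbTE uA) andbF.
  by case: eqVneq => [->|_] //=; rewrite (negbTE TB).
rewrite IH //; first last.
- by move=> x y; rewrite !inE => /andP[_ xA] /andP[_ yB]; apply: hAB.
- by apply/fdisjointP => x; rewrite !inE => /andP[_ /(fdisjointP dAB) /negbTE ->]; rewrite andbF.
rewrite [RHS](reindex_onto (fun V => k0 |: V) (fun V => V :\ k0)) /=; last first.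
  move=> V /andP[_]; rewrite negbK => /imageP[k kV] /injd ->.
  by rewrite setD1K.
apply: eq_big => [V|V].
  rewrite (_ : ((k0 |: V) :\ k0 == V) = (k0 \notin V)); last first.
    apply/eqP/idP => [<-|/setU1K //]; by rewrite !inE eqxx.
  rewrite -?dk0 image_f ?inE ?eqxx //= andbT.
  apply/forallP/andP => [h|[/forallP h nk0] k].
    split; last by apply/negP => hk; have := h k0; rewrite hk !inE dk0 eqxx.
    apply/forallP => k; rewrite !inE; case: eqVneq => [->|_] /=.
      by rewrite dk0 TA uk0.
    apply/implyP => kV; have := h k; rewrite kV !inE.
    by move=> /andP[/andP[_ ->] /andP[_ ->]].
  apply/implyP => kV; have := h k; rewrite !inE kV orbT /= => /andP[-> ->].
  have nk : k != k0 by apply: contraNneq nk0 => <-.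
  by rewrite !andbT dk0 -{1}dk0 (inj_eq injd) (inj_eq inju) nk.
move=> /forallP h; congr (M _ * M _)%N; apply/fsetP => x; rewrite !inE.
  rewrite -?dk0 andbAC; case: (x \in A); rewrite ?andbF //= ?andbT.
  rewrite -negb_or; congr (~~ _); apply/orP/imageP => [[/eqP ->|/imageP[k kV ->]]|[k]].
  - by exists k0; rewrite ?inE ?eqxx.
  - by exists k; rewrite ?inE ?kV ?orbT.
  - rewrite !inE => /orP[/eqP -> ->|kV ->]; first by left.
    by right; apply: image_f.
rewrite andbAC; case: (x \in B); rewrite ?andbF //= ?andbT.
rewrite -negb_or; congr (~~ _); apply/orP/imageP => [[/eqP ->|/imageP[k kV ->]]|[k]].
- by exists k0; rewrite ?inE ?eqxx.
- by exists k; rewrite ?inE ?kV ?orbT.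
- rewrite !inE => /orP[/eqP -> ->|kV ->]; first by left.
  by right; apply: image_f.
Qed.

(** * Peeling off the bottom row *)

(** State of a scan of the row from left to right, with [lo] the column reached. A row has one down
    triangle fewer than positions, hence [i + 1 < L]. *)
Definition in_row (lo L : nat) (P : seq nat) (T : utri) : bool :=
  let: (i, j, b) := T in
  (j == 0) && if b then [&& lo%:Z <= i, i < L%:Z & i \notin map Posz P]
              else (lo%:Z <= i) && (i + 1 < L%:Z).

(** Two consecutive rows of a Gelfand-Tsetlin pattern: one entry is chosen, independently, in each
    half-open interval between neighbours of [lo :: ps]. *)
Fixpoint interlacing (lo : nat) (ps : seq nat) : seq (seq nat) :=
  if ps is p :: ps' then
    [seq q :: qs | q <- iota lo (p - lo), qs <- interlacing p ps']
  else [:: [::]].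

Definition delete (R : region) (qs : seq nat) (j : int) : region :=
  [fset T in R | T \notin [seq (q%:Z, j, true) | q <- qs]]%fset.

Lemma mem_Posz (n : nat) (s : seq nat) : (n%:Z \in map Posz s) = (n \in s).
Proof. by rewrite mem_map // => x y []. Qed.

Lemma interlacingP lo ps qs : path ltn lo ps -> qs \in interlacing lo ps ->
  [/\ size qs = size ps, all (leq lo) qs, all (gtn (last lo ps)) qs
    & sorted ltn qs].
Proof.
elim: ps lo qs => [|p ps IH] lo qs /=; first by rewrite inE => _ /eqP ->.
move=> /andP[lop pps] /allpairsP[[q qs'] [/=]]; rewrite mem_iota => hq hqs' ->.
have [e1 e2 e3 e4] := IH _ _ pps hqs'.
have plast : (p <= last p ps)%N.
  have := order_path_min ltn_trans pps; case/lastP: (ps) => // s' x.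
  by rewrite last_rcons => /allP /(_ x) /=; rewrite mem_rcons inE eqxx => /(_ isT)/ltnW.
split; rewrite /= ?e1 //.
- apply/andP; split; first lia.
  by apply: sub_all e2 => x /=; lia.
- by rewrite e3 andbT; lia.
- rewrite path_min_sorted //; apply: sub_all e2 => x /=; lia.
Qed.

Lemma sum_seq3 (T : Type) (a b c : T) (P : pred T) (F : T -> nat) :
  (\sum_(x <- [:: a; b; c] | P x) F x =
  (if P a then F a else 0) + ((if P b then F b else 0) + (if P c then F c else 0)))%N.
Proof. by rewrite !big_cons big_nil; do 3!case: ifP; rewrite ?addn0. Qed.

Lemma path_ltn_notin p ps q : path ltn p ps -> (q <= p)%N -> q \notin ps.
Proof.
move=> pps le; apply/negP => /(allP (order_path_min ltn_trans pps)) /=.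
by rewrite ltnNge le.
Qed.

Section RowScan.
Variable L : nat.
Implicit Types (Up R : region).

(** The up triangles of the row can only be matched within the row, and they outnumber its down
    triangles by one. The scan forces the leftmost one onto the down triangle at its right until one
    is left alone. *)
Lemma M_row_nil Up R lo : (forall i j b, (i, j, b) \in Up -> 1 <= j) ->
  (forall T, (T \in R) = (T \in Up) || in_row lo L [::] T) ->
  (lo < L)%N -> M R = 0%N.
Proof.
move=> hUp; move: {2}(L - lo)%N (leqnn (L - lo)) => m.
elim: m R lo => [|m IH] R lo hm hR ltL; first lia.
have TR : (lo%:Z, 0, true) \in R by rewrite hR /=; lia.
have nUp i b : (i, 0, b) \notin Up by apply/negP => /hUp.
rewrite (M_expand_nbrs TR) /= !big_cons big_nil !hR /= !(negbTE (nUp _ _)) /=.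
have -> : (lo%:Z <= lo%:Z - 1) = false by lia.
rewrite (negbTE (_ : (lo%:Z, -1, false) \notin Up)) ?lexx /=; last by apply/negP => /hUp.
case: ifP => // ltlo; rewrite addn0; apply: (IH _ lo.+1); [lia| |lia].
case=> [[i j] b]; rewrite !inE !hR /= !xpair_eqE.
case: (boolP ((i, j, b) \in Up)) => [/hUp hj|_] /=; first by rewrite ?andbT; lia.
case: b; lia.
Qed.

(** Left of the first missing position [p], the leftmost up triangle has the down triangle at its
    right as only partner, so the scan reaches [p] without a choice. *)
Lemma M_row_cons Up R lo p ps : (forall i j b, (i, j, b) \in Up -> 1 <= j) ->
  (forall T, (T \in R) = (T \in Up) || in_row lo L (p :: ps) T) ->
  (lo <= p)%N -> (p < L)%N -> all (ltn p) ps ->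
  exists2 R' : region, M R = M R' &
    forall T, (T \in R') = (T \in Up) || in_row p L (p :: ps) T.
Proof.
move=> hUp; move: {2}(p - lo)%N (leqnn (p - lo)) => m.
elim: m R lo => [|m IH] R lo hm hR lep ltL hps.
  have e : lo = p by lia.
  by exists R => // T; rewrite hR e.
have [e|ne] := eqVneq lo p; first by exists R => // T; rewrite hR e.
have lops : lo%:Z \notin map Posz (p :: ps).
  rewrite mem_Posz inE negb_or ne; apply/negP => /(allP hps) /=; lia.
have TR : (lo%:Z, 0, true) \in R by rewrite hR /= lops; lia.
have nUp i b : (i, 0, b) \notin Up by apply/negP => /hUp.
have TR' : (lo%:Z, 0, false) \in R by rewrite hR /=; lia.
rewrite (M_expand_nbrs TR) /= !big_cons big_nil TR' !hR /= !(negbTE (nUp _ _)) /=.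
have -> : (lo%:Z <= lo%:Z - 1) = false by lia.
rewrite (negbTE (_ : (lo%:Z, -1, false) \notin Up)) ?lexx /=; last by apply/negP => /hUp.
rewrite addn0; apply: (IH _ lo.+1) => //; [lia| |lia].
case=> [[i j] b]; rewrite !inE !hR /= !xpair_eqE.
case: (boolP ((i, j, b) \in Up)) => [/hUp hj|_] /=; first by rewrite ?andbT; lia.
case: b; case: (i \in map Posz ps); lia.
Qed.

(* Scanning the row from left to right, the down triangle at lo is matched either
   with the next up triangle or, at the positions in qs, with the one above it; between
   a position in qs and the next position in ps the matching is forced. *)
Lemma M_row Up R lo ps : (forall i j b, (i, j, b) \in Up -> 1 <= j) ->
  (forall T, (T \in R) = (T \in Up) || in_row lo L (lo :: ps) T) ->
  (lo < L)%N -> path ltn lo ps -> all (gtn L) ps ->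
  M R = (\sum_(qs <- interlacing lo ps | all (fun q : nat => ((q%:Z, 1%R, true) : utri) \in Up) qs)
           M (delete Up qs 1%R))%N.
Proof.
move: {2}(L - lo)%N (leqnn (L - lo)) => m.
elim: m R Up lo ps => [|m IH] R Up lo ps hm hUp hR ltL pps hps; first lia.
have nUp i b : (i, 0, b) \notin Up by apply/negP => /hUp.
have [eL|ltlo] := leqP L lo.+1.
  have ps0 : ps = [::].
    case: (ps) pps hps => //= p ps' /andP[h _] /andP[h' _]; lia.
  rewrite ps0 /= big_cons big_nil /= addn0; congr M.
  apply/fsetP => -[[i j] b]; rewrite /delete !inE /= andbT hR ps0 /=.
  by case: ((i, j, b) \in Up) => //=; case: b; rewrite ?inE; lia.
have TR : (lo%:Z, 0, false) \in R by rewrite hR /=; lia.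
have n1 : ((lo%:Z, 0, true) \in R) = false.
  by rewrite hR (negbTE (nUp _ _)) /= !inE eqxx /= !andbF.
have n2 : ((lo%:Z + 1, 0, true) \in R) = (lo.+1 \notin ps).
  rewrite hR (negbTE (nUp _ _)) -mem_Posz (_ : lo%:Z + 1 = lo.+1%:Z); last lia.
  rewrite /= inE; case: (lo.+1%:Z \in map Posz ps); lia.
have n3 : ((lo%:Z, 0 + 1, true) \in R) = ((lo%:Z, 1, true) \in Up).
  by rewrite hR add0r /= orbF.
rewrite (M_expand_nbrs TR) [nbrs _]/=.
rewrite sum_seq3 n1 n2 n3 add0n [0 + 1]add0r.
have -> : lo%:Z + 1 = lo.+1%:Z by lia.
have hE : (if (lo%:Z, 1, true) \in Up
    then M (R `\ (lo%:Z, 0, false) `\ (lo%:Z, 1, true))%fset else 0%N)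
   = (if ps is p1 :: ps' then
     (\sum_(qs <- interlacing p1 ps' |
              all (fun q : nat => ((q%:Z, 1%R, true) : utri) \in Up) (lo :: qs))
           M (delete Up (lo :: qs) 1%R))%N else 0%N).
  case: ifP => hlo; last first.
    by case: (ps) => // p1 ps'; rewrite big1 // => qs /=; rewrite hlo.
  set R2 := (_ `\ _ `\ _)%fset; pose Up2 := (Up `\ (lo%:Z, 1, true))%fset.
  have hUp2 i j b : (i, j, b) \in Up2 -> 1 <= j by rewrite !inE => /andP[_ /hUp].
  have hR2 T : (T \in R2) = (T \in Up2) || in_row lo.+1 L ps T.
    case: T => [[i j] b]; rewrite !inE hR /= !xpair_eqE.
    case: (boolP ((i, j, b) \in Up)) => [/hUp hj|_] /=; first by lia.
    rewrite inE; case: b; case: (i \in map Posz ps); lia.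
  case: (ps) pps hps hR2 => [|p1 ps'] /= pps hps hR2; first exact: M_row_nil hUp2 hR2 _.
  have [lt1 pp1] := andP pps; have [ltp1 hps'] := andP hps.
  have [||R3 -> hR3] := M_row_cons hUp2 hR2 _ ltp1 => //.
    by apply: order_path_min pp1; apply: ltn_trans.
  rewrite (IH R3 Up2 p1 ps') //; last by lia.
  rewrite big_seq_cond [RHS]big_seq_cond; apply: eq_big => [qs|qs /andP[qsI _]].
    case: (boolP (qs \in _)) => //= qsI; rewrite hlo /=.
    have [_ /allP hq _ _] := interlacingP pp1 qsI.
    apply: eq_in_all => q /hq lq; rewrite !inE !xpair_eqE.
    by rewrite (_ : (q%:Z == lo%:Z) = false) //; lia.
  congr M; apply/fsetP => T; rewrite !inE negb_or; case: (T \in Up); rewrite ?andbF //=.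
  by rewrite andbT.
rewrite {}hE {n2}; case: ps pps hps hR => [|p1 ps'] /= pps hps hR.
  rewrite addn0 (IH _ Up lo.+1 [::]) //; first lia.
  case=> [[i j] b]; rewrite !inE hR /= !xpair_eqE !inE.
  case: (boolP ((i, j, b) \in Up)) => [/hUp hj|_] /=; first by lia.
  case: b; lia.
have [lt1 pp1] := andP pps.
have -> : (p1 - lo)%N = (p1 - lo.+1).+1 by lia.
rewrite /= big_cat big_map addnC; congr (_ + _)%N.
rewrite inE negb_or; have [e|ne] /= := eqVneq lo.+1 p1.
  by rewrite e subnn big_nil.
have nin : lo.+1 \notin ps' := path_ltn_notin pp1 lt1.
rewrite nin (IH _ Up lo.+1 (p1 :: ps')) //=; [lia| |by rewrite pp1 andbT; lia].
case=> [[i j] b]; rewrite !inE hR /= !xpair_eqE !inE.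
case: (boolP ((i, j, b) \in Up)) => [/hUp hj|_] /=; first by lia.
have hi : (i \in map Posz ps') -> p1%:Z < i.
  by move=> /mapP[q /(allP (order_path_min ltn_trans pp1)) hq ->]; rewrite ltz_nat.
move: (i \in map Posz ps') hi ltlo lt1 ne; clear=> c.
case: b; rewrite ?(andbF, andbT) /=.
  case: (j == 0); rewrite ?(andbF, andbT) //=.
  by case: c => [/(_ isT)|_]; rewrite /= ?orbT ?orbF ?andbF //; lia.
lia.
Qed.
End RowScan.

(** * Summing [vdm] over interlacing sequences *)

Fixpoint vdm (s : seq nat) : nat :=
  if s is x :: s' then (\prod_(y <- s') `|x - y| * vdm s')%N else 1%N.

(** Rows are functions on all of [nat], so that a row can be written down and replaced without
    reference to the size of the matrix. *)
Definition row_det (n : nat) (rows : seq (nat -> rat)) : rat :=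
  \det (\matrix_(i < n, k < n) nth (fun=> 0) rows i k).

Definition bin_row (q : nat) : nat -> rat := fun k => 'C(q, k)%:R.

Lemma row_det_sum (I : Type) n (xs : seq I) (F : I -> nat -> rat) pre post :
  (size pre < n)%N ->
  row_det n (pre ++ (fun k => \sum_(x <- xs) F x k) :: post) =
  \sum_(x <- xs) row_det n (pre ++ F x :: post).
Proof.
move=> ltn; pose i0 : 'I_n := Ordinal ltn.
have rowE f : row i0 (\matrix_(i < n, k < n) nth (fun=> 0) (pre ++ f :: post) i k)
    = \row_k f k.
  by apply/rowP => k; rewrite !mxE nth_cat ltnn subnn.
have row'E f g : row' i0 (\matrix_(i < n, k < n) nth (fun=> 0) (pre ++ f :: post) i k)
    = row' i0 (\matrix_(i < n, k < n) nth (fun=> 0) (pre ++ g :: post) i k).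
  apply/matrixP => i k; rewrite !mxE !nth_cat.
  case: ltngtP => // [lt|e].
    by rewrite -(subnSK lt).
  by have := neq_lift i0 i; rewrite -val_eqE /= -[X in _ == X]/(nat_of_ord (lift i0 i)) e eqxx.
elim: xs => [|x xs IH].
  rewrite big_nil /row_det.
  set A := (X in \det X).
  rewrite (@determinant_multilinear _ _ A A A i0 0 0) ?mul0r ?addr0 //.
  by rewrite !scale0r addr0 /A rowE; apply/rowP => k; rewrite !mxE big_nil.
rewrite big_cons -IH /row_det.
rewrite (@determinant_multilinear _ _ _
  (\matrix_(i < n, k < n) nth (fun=> 0) (pre ++ F x :: post) i k)
  (\matrix_(i < n, k < n) nth (fun=> 0) (pre ++ (fun k => \sum_(x <- xs) F x k) :: post) i k) i0 1 1) ?mul1r //.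
by rewrite !rowE; apply/rowP => k; rewrite !mxE big_cons !mul1r.
Qed.

(** The hockey-stick identity, in a form without subtraction. *)
Lemma sum_bin_iota lo m k :
  (\sum_(q <- iota lo m) 'C(q, k) + 'C(lo, k.+1) = 'C(lo + m, k.+1))%N.
Proof.
elim: m lo => [|m IH] lo /=; first by rewrite big_nil addn0.
by rewrite big_cons -addSnnS -IH binS [('C(lo, k) + \sum_(q <- _) _)%N]addnC
  -addnA [('C(lo, k) + _)%N]addnC.
Qed.

Fixpoint bin_diffs (lo : nat) (ps : seq nat) : seq (nat -> rat) :=
  if ps is p :: ps' then
    (fun k => 'C(p, k.+1)%:R - 'C(lo, k.+1)%:R) :: bin_diffs p ps'
  else [::].

(** The entries of an interlacing sequence range over independent intervals, so by multilinearity
    each sum moves into its own row, where the hockey-stick identity evaluates it. [pre] holds the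
    rows already fixed. *)
Lemma sum_interlacing_row_det n pre lo ps :
  path ltn lo ps -> (size pre + size ps = n)%N ->
  \sum_(qs <- interlacing lo ps) row_det n (pre ++ map bin_row qs) =
  row_det n (pre ++ bin_diffs lo ps).
Proof.
elim: ps pre lo => [|p ps IH] pre lo /=.
  by rewrite big_cons big_nil addr0.
move=> /andP[lop pps] hs; rewrite big_allpairs_dep /=.
rewrite (eq_bigr (fun q => row_det n (pre ++ bin_row q :: bin_diffs p ps))); last first.
  move=> q _; rewrite -cat_rcons -IH ?size_rcons //; last by lia.
  by apply: eq_bigr => qs _; rewrite cat_rcons.
have ltn : (size pre < n)%N by rewrite -hs addnS ltnS leq_addr.
rewrite -(row_det_sum _ _ _ ltn).
congr (\det _); apply/matrixP => i k; rewrite !mxE !nth_cat; case: ifP => // _.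
case: (i - size pre)%N => //=; rewrite /bin_row -natr_sum.
by apply/eqP; rewrite eq_sym subr_eq -natrD sum_bin_iota subnKC // ltnW.
Qed.

Lemma nth_bin_diffs lo ps i k : (i < size ps)%N ->
  nth (fun=> 0) (bin_diffs lo ps) i k =
  'C(nth 0 (lo :: ps) i.+1, k.+1)%:R - 'C(nth 0 (lo :: ps) i, k.+1)%:R.
Proof.
by elim: ps lo i => [|p ps IH] lo [|i] //= lti; rewrite IH.
Qed.

(* Subtracting from each row the previous one clears the first column. *)
Lemma row_det_bin_diffs n lo ps : size ps = n ->
  row_det n (bin_diffs lo ps) = row_det n.+1 (map bin_row (lo :: ps)).
Proof.
move=> sps; set A := (X in _ = \det X).
pose Lm : 'M[rat]_n.+1 := \matrix_(i, j) ((i == j)%:R - (i == j.+1 :> nat)%:R).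
have detL : \det Lm = 1.
  rewrite det_trig; last first.
    apply/is_trig_mxP => i j lt; rewrite mxE -val_eqE /=.
    by rewrite !ltn_eqF // ltnS ltnW.
  by rewrite big1 // => i _; rewrite mxE eqxx [_ == _.+1]ltn_eqF // subr0.
have AE i k : A i k = 'C(nth 0 (lo :: ps) i, k)%:R.
  by rewrite mxE (nth_map 0%N) //= sps.
have LA0 k : (Lm *m A) 0 k = A 0 k.
  rewrite mxE (bigD1 ord0) //= big1 ?addr0; last first.
    by move=> j /negbTE nj; rewrite mxE eq_sym nj /= subrr mul0r.
  by rewrite mxE eqxx subr0 mul1r.
have LAS (i : 'I_n) k : (Lm *m A) (lift ord0 i) k =
    A (lift ord0 i) k - A (widen_ord (leqnSn n) i) k.
  rewrite mxE (bigD1 (lift ord0 i)) //= (bigD1 (widen_ord (leqnSn n) i)) /=; last first.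
    by rewrite -val_eqE /= /bump /= ltn_eqF.
  rewrite big1 ?addr0; last first.
    move=> j /andP[n1 n2]; rewrite mxE eq_sym (negbTE n1).
    rewrite (_ : (lift ord0 i == j.+1 :> nat) = false) ?subrr ?mul0r //.
    by apply: contraNF n2; rewrite lift0 eqSS => /eqP e; apply/eqP/val_inj; rewrite /= e.
  rewrite !mxE eqxx -val_eqE /= /bump /= !add1n eqxx [_ == _.+2]ltn_eqF // subr0 mul1r.
  by rewrite [_.+1 == _]gtn_eqF // sub0r mulN1r.
rewrite -[RHS]mul1r -detL -det_mulmx (expand_det_col _ ord0) big_ord_recl big1 ?addr0.
  rewrite LA0 AE bin0 mul1r /cofactor /= expr0 mul1r.
  congr (\det _); apply/matrixP => i k; rewrite mxE [RHS]mxE [RHS]mxE LAS !AE.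
  by rewrite nth_bin_diffs ?sps.
move=> i _; rewrite LAS !AE !bin0 subrr mul0r //.
Qed.

(** The falling factorial, with value k! C(p, k) at a natural number p. *)
Definition ff_poly (k : nat) : {poly rat} := \prod_(t < k) ('X - (t%:R)%:P).

Lemma size_ff_poly k : size (ff_poly k) = k.+1.
Proof. by rewrite /ff_poly size_prod_XsubC /index_enum -enumT size_enum_ord. Qed.

Lemma monic_ff_poly k : ff_poly k \is monic.
Proof. exact: monic_prod_XsubC. Qed.

Lemma horner_ff_poly k p : (ff_poly k).[p%:R] = (p ^_ k)%:R.
Proof.
elim: k => [|k IH]; first by rewrite /ff_poly big_ord0 hornerC ffactn0.
rewrite /ff_poly big_ord_recr /= hornerM -/(ff_poly k) IH !hornerE ffactnSr natrM.
have [le|lt] := leqP k p; first by rewrite natrB.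
by rewrite ffact_small // !mul0r.
Qed.

(** Scaling column k by k! turns the binomials into values of the monic polynomial [ff_poly k] of
    degree k. The matrix [S] of coefficients is unitriangular, so the determinant is that of
    Vandermonde. *)
Lemma row_det_bin n ps : size ps = n ->
  row_det n (map bin_row ps) * (hyperfact n)%:R =
  \prod_(i < n) \prod_(j < n | (i < j)%N) ((nth 0 ps j)%:R - (nth 0 ps i)%:R).
Proof.
move=> sps; pose v : 'rV[rat]_n := \row_j (nth 0%N ps j)%:R.
transitivity (\det (Vandermonde n v)); last first.
  rewrite det_Vandermonde; apply: eq_bigr => i _; apply: eq_bigr => j _.
  by rewrite !mxE.
pose S : 'M[rat]_n := \matrix_(m, k) (ff_poly k)`_m.
have detS : \det S = 1.
  rewrite -det_tr det_trig; last first.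
    apply/is_trig_mxP => i j lt; rewrite !mxE nth_default // size_ff_poly.
    by [].
  rewrite big1 // => i _; rewrite !mxE.
  by have /monicP := monic_ff_poly i; rewrite /lead_coef size_ff_poly.
have -> : (hyperfact n)%:R = \det (diag_mx (\row_(k < n) (k`!)%:R : 'rV[rat]_n)).
  rewrite det_diag /hyperfact natr_prod; apply: eq_bigr => k _.
  by rewrite mxE.
rewrite -det_mulmx -[RHS]mulr1 -[X in _ = _ * X]detS -(det_tr (Vandermonde n v)) -det_mulmx.
congr (\det _); apply/matrixP => i k; rewrite mul_mx_diag !mxE (nth_map 0%N) ?sps //.
rewrite /bin_row -natrM bin_ffact -horner_ff_poly.
rewrite (@horner_coef_wide _ n) ?size_ff_poly //.
by apply: eq_bigr => m _; rewrite !mxE mulrC.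
Qed.

Lemma vdm_sorted ps : sorted ltn ps ->
  (vdm ps)%:R = \prod_(i < size ps) \prod_(j < size ps | (i < j)%N)
    ((nth 0%N ps j)%:R - (nth 0%N ps i)%:R) :> rat.
Proof.
elim: ps => [|p ps IH] /=; first by rewrite big_ord0.
move=> pps; rewrite natrM IH ?(path_sorted pps) // big_ord_recl /=; congr (_ * _).
  rewrite [RHS]big_mkcond big_ord_recl /= mul1r natr_prod (big_nth 0%N) big_mkord.
  apply: eq_bigr => i _ /=.
  have /allP /(_ _ (mem_nth 0%N (ltn_ord i))) /= := order_path_min ltn_trans pps.
  by move=> lt; rewrite distnEr ?natrB // ltnW.
apply: eq_bigr => i _; rewrite [RHS]big_mkcond big_ord_recl /= mul1r big_mkcond.
by apply: eq_bigr.
Qed.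

(** The induction step of the trapezoid formula. Both sides are binomial determinants, of sizes
    differing by one, and the factorial is the ratio of their hyperfactorials. *)
Lemma sum_interlacing_vdm lo ps : path ltn lo ps ->
  ((\sum_(qs <- interlacing lo ps) vdm qs) * (size ps)`! = vdm (lo :: ps))%N.
Proof.
move=> pps; apply/eqP; rewrite -(eqr_nat rat) natrM natr_sum.
have sS : (size (lo :: ps) = (size ps).+1)%N by [].
rewrite (vdm_sorted (ps := lo :: ps)) // -(row_det_bin sS).
rewrite -row_det_bin_diffs // -[bin_diffs _ _]cat0s -sum_interlacing_row_det //.
have Hn m : hyperfact m.+1 = (hyperfact m * m`!)%N by rewrite /hyperfact big_ord_recr.
rewrite /= Hn natrM mulrA; apply/eqP; congr (_ * _); rewrite mulr_suml.
apply: eq_big_seq => qs qsI; have [sq _ _ sorq] := interlacingP pps qsI.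
by rewrite /= row_det_bin // vdm_sorted // sq.
Qed.

(** * Membership in the regions as linear inequalities *)

Lemma mem_box i j b l w h :
  ((i, j, b) \in box l w h) = [&& l <= i, i < l + w%:Z, 0 <= j & j < h%:Z].
Proof.
apply/allpairsP/and4P => [[[[i' j'] b'] [/= /allpairsP[[i1 j1] /= [h1 h2 [-> ->]]] _ [-> -> _]]]|].
  by rewrite !mem_iota in h1 h2; split; lia.
move=> [h1 h2 h3 h4]; exists ((`|i - l|%N, `|j|%N), b); split => /=.
- apply/allpairsP; exists (`|i - l|%N, `|j|%N); rewrite /= !mem_iota; split=> //; lia.
- by case: b.
- by congr (_, _, _); lia.
Qed.

(** The term 1 or 2 is the excess over [i + j] of the largest coordinate sum among the vertices. *)
Lemma inside_up p q t i j b : inside (triangle true (p, q) t) (i, j, b) =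
  [&& p <= i, q <= j & i + j + (if b then 1 else 2) <= p + q + t%:Z].
Proof. by rewrite /inside; case: b; rewrite /= /triangle /=; lia. Qed.

Lemma inside_down p q t i j b : inside (triangle false (p, q) t) (i, j, b) =
  [&& i + 1 <= p + t%:Z, j + 1 <= q & p + q <= i + j + (if b then 0 else 1)].
Proof. by rewrite /inside; case: b; rewrite /= /triangle /=; lia. Qed.

Lemma mem_sep (R : region) (p : pred utri) T :
  (T \in [fset T' in R | p T']%fset) = (T \in R) && p T.
Proof. by rewrite !inE. Qed.

Lemma mem_delete (R : region) P k i j b : ((i, j, b) \in delete R P k) =
  ((i, j, b) \in R) && ~~ [&& b, j == k & i \in map Posz P].
Proof.
rewrite mem_sep; congr (_ && ~~ _).
apply/mapP/and3P => [[q qP [-> -> ->]]|[hb /eqP -> /mapP[q qP ->]]].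
  by rewrite mem_Posz.
by exists q; rewrite ?hb.
Qed.

Lemma mem_trapezoid e n i j b : ((i, j, b) \in trapezoid e n) =
  [&& 0 <= i, 0 <= j, j + 1 <= n%:Z
    & i + j + (if b then 1 else 2) <= n%:Z + e%:Z].
Proof.
rewrite /trapezoid /region_of !inE /= mem_box /inside /trapezoid_points.
by case: b => /=; lia.
Qed.

Lemma mem_hexagon n ne se s sw nw i j b : (n + ne = s + sw)%N ->
  ((i, j, b) \in hexagon n ne se s sw nw) =
  [&& 0 <= j, j + 1 <= (ne + se)%N%:Z, - sw%:Z <= i, i + 1 <= s%:Z,
      0 <= i + j + (if b then 0 else 1)
    & i + j + (if b then 1 else 2) <= (s + se)%N%:Z].
Proof.
move=> e; rewrite /hexagon /region_of !inE /= mem_box /inside /hexagon_points.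
by case: b => /=; lia.
Qed.

Local Opaque trapezoid hexagon M.

(** * Translations, and trapezoids with unit dents *)

Definition shift (u v : int) (T : utri) : utri :=
  let: (i, j, b) := T in (i + u, j + v, b).

Lemma shiftK u v : cancel (shift u v) (shift (- u) (- v)).
Proof. by case=> [[i j] b]; rewrite /shift !addrK. Qed.

Lemma share_edge_shift u v T T' :
  share_edge (shift u v T) (shift u v T') = share_edge T T'.
Proof.
case: T T' => [[i j] b] [[i' j'] b']; rewrite !share_edgeE.
rewrite !(addrAC _ _ (-1)) !(addrAC _ _ 1) !(inj_eq (addIr _)).
by [].
Qed.

Lemma M_shift u v (R R' : region) :
  (forall T, (shift u v T \in R') = (T \in R)) -> M R = M R'.
Proof.
apply: M_iso (shiftK u v) _ (share_edge_shift u v).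
by move=> T; have := shiftK (- u) (- v) T; rewrite !opprK.
Qed.

Lemma vdm_perm s t : perm_eq s t -> vdm s = vdm t.
Proof.
have swap x y (r : seq nat) : vdm (x :: y :: r) = vdm (y :: x :: r).
  rewrite /= !big_cons distnC; nia.
have cons_congr z u w : vdm u = vdm w -> perm_eq u w -> vdm (z :: u) = vdm (z :: w).
  by move=> e p; rewrite /= e (perm_big _ p).
have cat_swap x r1 r2 : vdm (r1 ++ x :: r2) = vdm (x :: r1 ++ r2).
  elim: r1 => // y r1 IH; rewrite !cat_cons (swap x y); apply: cons_congr => //.
  by rewrite -cat1s perm_catCA.
elim: s t => [|x s IH] t; first by rewrite perm_sym => /perm_nilP ->.
move=> pst; have xt : x \in t by rewrite -(perm_mem pst) inE eqxx.
case/splitPr: xt pst => t1 t2 pst; rewrite cat_swap /=.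
move: pst; rewrite perm_sym -cat1s perm_catCA /= perm_cons perm_sym => pst.
by rewrite (IH _ pst) (perm_big _ pst).
Qed.

Lemma vdm_cat s t :
  vdm (s ++ t) = (vdm s * vdm t * \prod_(x <- s) \prod_(y <- t) `|x - y|)%N.
Proof.
elim: s => [|x s IH] /=; first by rewrite big_nil mul1n muln1.
by rewrite IH big_cons big_cat /=; nia.
Qed.

Lemma hyperfactS n : hyperfact n.+1 = (hyperfact n * n`!)%N.
Proof. by rewrite /hyperfact big_ord_recr. Qed.

(** Induction on the height: [M_row] leaves a trapezoid one row lower, with the positions [qs]
    deleted. The value 0 for a wrong number of dents is kept because the cut sums over sets [V] of
    every size. The last hypothesis excludes dents in a trapezoid of height 0, which has one empty
    tiling whatever is deleted. *)
Lemma M_delete_trapezoid_sorted e n P : sorted ltn P ->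
  all (gtn (n + e)%N) P -> (0 < n)%N || nilp P ->
  (M (delete (trapezoid e n) P 0) * hyperfact n =
  if size P == n then vdm P else 0)%N.
Proof.
elim: n P => [|n IH] P sP aP.
  case: P {sP aP} => //= _; rewrite /hyperfact big_ord0 muln1.
  rewrite -M_fset0; congr M; apply/fsetP => -[[i j] b].
  by rewrite mem_delete inE mem_trapezoid; lia.
move=> _; set R := delete _ _ _.
pose Up : region := [fset T in trapezoid e n.+1 | 1 <= T.1.2]%fset.
have hUp i j b : (i, j, b) \in Up -> 1 <= j by rewrite mem_sep => /andP[].
have hR T : (T \in R) = (T \in Up) || in_row 0 (n.+1 + e) P T.
  case: T => [[i j] b]; rewrite [LHS]mem_delete [X in _ = X || _]mem_sep mem_trapezoid /=.
  case: (i \in map Posz P); case: b => /=; lia.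
case: P => [|p0 ps] in sP aP R hR *.
  by rewrite (M_row_nil hUp hR) //; lia.
have pps : path ltn p0 ps := sP; have [ltp0 aps] := andP aP; clear sP aP.
have [R' -> hR'] :=
  M_row_cons hUp hR (leq0n _) ltp0 (order_path_min ltn_trans pps).
rewrite (M_row hUp hR') //.
have delM qs : M (delete Up qs 1) = M (delete (trapezoid e n) qs 0).
  symmetry; apply: (@M_shift 0 1) => -[[i j] b].
  rewrite [shift _ _ _]/= [LHS]mem_delete [RHS]mem_delete [X in X && _ = _]mem_sep.
  rewrite !mem_trapezoid addr0 /=.
  case: (i \in map Posz qs); case: b; rewrite ?andbF ?andbT //=; lia.
(* At height one there is no row above: only the empty [qs] can occur, so two or more dents leave no
   tiling. *)
have [n0|n0] := posnP n.
  rewrite n0 /hyperfact big_ord_recr big_ord0 /= muln1.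
  rewrite big_seq_cond; case: ps => [|p1 ps] in pps aps R hR hR' *.
    rewrite /= big_cons big_nil /= addn0 delM n0.
    have := IH [::]; rewrite n0 /= /hyperfact big_ord0 muln1 => -> //.
    by rewrite /= big_nil.
  rewrite big_pred0 // => qs; apply/negP => /andP[qsI].
  have [sq _ _ _] := interlacingP pps qsI.
  by case: qs sq {qsI} => //= q qs _ /andP[]; rewrite mem_sep mem_trapezoid; lia.
rewrite hyperfactS mulnA -sum_interlacing_vdm // big_distrl /=.
rewrite [size _]/= eqSS; transitivity ((\sum_(qs <- interlacing p0 ps)
    if size ps == n then vdm qs else 0) * n`!)%N; last first.
  by case: eqP => [->//|_]; rewrite big1.
congr (_ * _)%N; rewrite big_seq_cond [RHS]big_seq_cond.
apply: eq_big => [qs|qs /andP[qsI _]].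
  case: (boolP (qs \in _)) => //= qsI; apply/allP => q qq.
  have [_ _ /allP /(_ _ qq) /= lq _] := interlacingP pps qsI.
  have : (last p0 ps < n.+1 + e)%N.
    by have := mem_last p0 ps; rewrite inE => /orP[/eqP -> //|/(allP aps)].
  by rewrite mem_sep mem_trapezoid /=; lia.
have [sq _ /allP lq srt] := interlacingP pps qsI.
rewrite delM IH ?sq ?n0 //; apply/allP => q /lq /= ltq.
have : (last p0 ps < n.+1 + e)%N.
  by have := mem_last p0 ps; rewrite inE => /orP[/eqP -> //|/(allP aps)].
by lia.
Qed.

Lemma M_delete_trapezoid e n P : uniq P ->
  all (gtn (n + e)%N) P -> (0 < n)%N || nilp P ->
  (M (delete (trapezoid e n) P 0) * hyperfact n =
  if size P == n then vdm P else 0)%N.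
Proof.
move=> uP aP nP; pose Q := sort leq P.
have pQ : perm_eq Q P by rewrite perm_sort.
rewrite -(perm_size pQ) -(vdm_perm pQ).
have -> : delete (trapezoid e n) P 0 = delete (trapezoid e n) Q 0.
  by apply/fsetP => -[[i j] b]; rewrite [LHS]mem_delete [RHS]mem_delete (perm_mem (perm_map _ pQ)).
apply: M_delete_trapezoid_sorted.
- by rewrite ltn_sorted_uniq_leq (perm_uniq pQ) uP; apply: sort_sorted leq_total _.
- by rewrite (perm_all _ pQ).
- by rewrite /nilp (perm_size pQ).
Qed.

Local Opaque delete.

(** * Trapezoids with triangular dents, and positions along a line *)

Definition bases (ds : seq (nat * nat)) : seq nat :=
  flatten [seq iota d.1 d.2 | d <- ds].

Definition tris (ds : seq (nat * nat)) : seq (pred point) :=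
  [seq triangle true (d.1%:Z, 0) d.2 | d <- ds].

Definition in_tris (ds : seq (nat * nat)) (T : utri) : bool :=
  has (fun P => inside P T) (tris ds).

Lemma in_trisP ds i j b : reflect
  (exists2 d, d \in ds & [&& d.1%:Z <= i, 0 <= j
     & i + j + (if b then 1 else 2) <= d.1%:Z + d.2%:Z]) (in_tris ds (i, j, b)).
Proof.
rewrite /in_tris has_map; apply: (iffP hasP) => -[d dds];
by rewrite /= ?inside_up ?addr0; exists d; rewrite // inside_up addr0.
Qed.

Lemma mem_bases ds (i : nat) : reflect
  (exists2 d, d \in ds & (d.1 <= i < d.1 + d.2)%N) (i \in bases ds).
Proof.
apply: (iffP flattenP) => [[s /mapP[d dds ->]]|[d dds h]].
  by rewrite mem_iota; exists d.
exists (iota d.1 d.2); last by rewrite mem_iota.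
exact: (map_f (fun d : nat * nat => iota d.1 d.2) dds).
Qed.

Lemma int_nonneg_nat (i : int) : 0 <= i -> exists m : nat, i = m%:Z.
Proof. by case: i => // m _; exists m. Qed.

(** A dent of side t amounts to t unit dents along its base: above those, working upwards, each down
    triangle inside the dent can only be paired with the up triangle above it. *)
Lemma M_dented e n ds : all (fun d => d.2 <= n)%N ds -> uniq (bases ds) ->
  all (gtn (n + e)%N) (bases ds) ->
  (M (remove (trapezoid e n) (tris ds)) * hyperfact n =
  if size (bases ds) == n then vdm (bases ds) else 0)%N.
Proof.
move=> le_n uB aB; rewrite -(@M_delete_trapezoid e) //; last first.
  have [n0|//] := posnP n; rewrite /nilp /bases size_flatten.
  rewrite /shape -map_comp sumnE big_map big1_seq // => d /andP[_ /(allP le_n)].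
  by rewrite n0 leqn0 /= size_iota => /eqP.
congr (_ * _)%N; set R := delete _ _ _.
have memR i j b := mem_delete (trapezoid e n) (bases ds) 0 i j b.
rewrite -/R in memR.
pose K : seq point :=
  [seq T.1 | T <- enum_fset (trapezoid e n) & ~~ T.2 && in_tris ds T].
have memK i j : ((i, j) \in K) =
    ((i, j, false) \in trapezoid e n) && in_tris ds (i, j, false).
  apply/mapP/andP => [[[p b]]|[h1 h2]].
    by rewrite mem_filter /= => /andP[/andP[/negbTE -> h1] h2] ->.
  by exists (i, j, false) => //; rewrite mem_filter h2.
have uK : uniq K.
  rewrite map_inj_in_uniq ?filter_uniq ?fset_uniq //.
  move=> [p b] [p' b']; rewrite !mem_filter /=.
  by move=> /andP[/andP[/negbTE -> _] _] /andP[/andP[/negbTE -> _] _] ->.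
have baseP d (i : nat) : d \in ds -> (d.1 <= i < d.1 + d.2)%N -> (i < n + e)%N.
  by move=> dds h; apply: (allP aB); apply/mem_bases; exists d.
rewrite (@M_forced_vertical R K) //; last first.
- move=> i j; rewrite !memK => /andP[h1 /in_trisP[d dds h2]].
  rewrite memR; move: h1; rewrite !mem_trapezoid => h1.
  (* At level 0 this up triangle would stand on the base of the dent, where [R] has nothing left. *)
  move=> /andP[h3 h4]; have jpos : 1 <= j.
    rewrite leNgt; apply: contra h4 => h4; apply/and3P; split=> //; first lia.
    have [|m em] := @int_nonneg_nat (i + 1); first lia.
    rewrite em mem_Posz; apply/mem_bases; exists d => //; lia.
  apply/andP; split; first lia.
  by apply/in_trisP; exists d => //; lia.
- move=> i j; rewrite !memK => /andP[h1 /in_trisP[d dds h2]].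
  rewrite memR; move: h1; rewrite !mem_trapezoid => h1.
  move=> /andP[h3 h4]; have jpos : 1 <= j.
    rewrite leNgt; apply: contra h4 => h4; apply/and3P; split=> //; first lia.
    have [|m em] := @int_nonneg_nat i; first lia.
    rewrite em mem_Posz; apply/mem_bases; exists d => //; lia.
  apply/andP; split; first lia.
  by apply/in_trisP; exists d => //; lia.
- move=> i j; rewrite memK => /andP[h1 /in_trisP[d dds h2]].
  rewrite !memR h1.
  move: h1; rewrite !mem_trapezoid => h1.
  have := allP le_n _ dds => /= hd; split => //.
  by rewrite (_ : (j + 1 == 0) = false) ?andbT; lia.
congr M; apply/fsetP => -[[i j] b]; rewrite [LHS]mem_sep [RHS]mem_sep memR.
rewrite -/(in_tris ds _); case: b; rewrite ?memK /=; last first.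
  by rewrite !andbT; case: (_ \in trapezoid _ _).
rewrite -andbA; case: (boolP (_ \in trapezoid _ _)) => //=.
rewrite mem_trapezoid => hT; rewrite -negb_or; congr (~~ _).
apply/in_trisP/orP => [[d dds h]|].
  have [j0|j0] := eqVneq j 0.
    left; have [|m em] := @int_nonneg_nat i; first lia.
    by rewrite em mem_Posz; apply/mem_bases; exists d => //; lia.
  right; apply/andP; split; last by apply/in_trisP; exists d => //; lia.
  have := allP le_n _ dds => /= hd.
  (* [m] is the last unit position of the base; its bound [n + e] keeps the dent left of the right
     side of the trapezoid. *)
  have [m em] : exists m : nat, (d.1 + d.2)%N = m.+1 by exists (d.1 + d.2).-1; lia.
  by rewrite mem_trapezoid; have := baseP d m dds; lia.
case=> [/andP[/eqP -> /mapP[m /mem_bases[d dds h] ->]]|/andP[_ /in_trisP[d dds h]]].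
  by exists d => //; lia.
by exists d => //; lia.
Qed.

(* Up to translation, the reflection in a horizontal line: it maps e1 to e1 and
   e2 to e1 - e2. *)
Definition flip (u v : int) (T : utri) : utri :=
  let: (i, j, b) := T in (i + j + u + (if b then 0 else 1), v - j, ~~ b).

Lemma flipK u v : cancel (flip u v) (flip (- u - v - 1) v).
Proof. by case=> [[i j] []]; rewrite /flip /=; congr (_, _, _); lia. Qed.

Lemma flipVK u v : cancel (flip (- u - v - 1) v) (flip u v).
Proof. by case=> [[i j] []]; rewrite /flip /=; congr (_, _, _); lia. Qed.

Lemma share_edge_flip u v T T' :
  share_edge (flip u v T) (flip u v T') = share_edge T T'.
Proof.
case: T T' => [[i j] b] [[i' j'] b']; rewrite !share_edgeE.
by case: b; case: b' => //=; apply/idP/idP; lia.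
Qed.

Lemma M_flip u v (R R' : region) :
  (forall T, (flip u v T \in R') = (T \in R)) -> M R = M R'.
Proof. exact: M_iso (flipK u v) (flipVK u v) (share_edge_flip u v). Qed.

(* The line is divided into segments of lengths p, g1, c, g2 and q; the lozenges may
   cross it in the gaps g1 and g2. *)
Definition gap_pos (p g1 c g2 : nat) (k : 'I_(g1 + g2)) : nat :=
  if (k < g1)%N then (p + k)%N else (p + c + k)%N.

Definition three_intervals (p g1 c g2 q : nat) : seq nat :=
  iota 0 p ++ iota (p + g1) c ++ iota (p + g1 + c + g2) q.

Definition gap_sum (p g1 c g2 q z : nat) : nat :=
  (\sum_(V : {set 'I_(g1 + g2)} | #|V| == z)
    vdm [seq gap_pos p c k | k in V] ^ 2 *
    \prod_(y <- three_intervals p g1 c g2 q)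
      \prod_(v <- [seq gap_pos p c k | k in V]) `|y - v|)%N.

Lemma gap_pos_inj p g1 c g2 : injective (@gap_pos p g1 c g2).
Proof.
move=> k k'; rewrite /gap_pos => h; apply: val_inj => /=.
by move: h; case: ifP; case: ifP; lia.
Qed.

Lemma gap_pos_bounds p g1 c g2 (k : 'I_(g1 + g2)) :
  (p <= gap_pos p c k < p + g1 + c + g2)%N.
Proof. by have := ltn_ord k; rewrite /gap_pos; case: ifP; lia. Qed.

Lemma gap_posP p g1 c g2 q i : (i < p + g1 + c + g2 + q)%N ->
  reflect (exists k : 'I_(g1 + g2), i = gap_pos p c k)
          (i \notin three_intervals p g1 c g2 q).
Proof.
move=> lti; rewrite !mem_cat !mem_iota.
apply: (iffP idP) => [h|[k ->]]; last first.
  by have := ltn_ord k; rewrite /gap_pos; case: ifP; lia.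
have [lt1|le1] := ltnP i (p + g1).
  have lt : (i - p < g1 + g2)%N by lia.
  by exists (Ordinal lt); rewrite /gap_pos /=; case: ifP; lia.
have lt : (i - p - c < g1 + g2)%N by lia.
by exists (Ordinal lt); rewrite /gap_pos /=; case: ifP; lia.
Qed.

Lemma uniq_three_intervals p g1 c g2 q : uniq (three_intervals p g1 c g2 q).
Proof.
rewrite !cat_uniq !iota_uniq /= andbT; apply/andP; split.
  by apply/hasPn => i; rewrite mem_cat !mem_iota; lia.
by apply/hasPn => i; rewrite !mem_iota; lia.
Qed.

Lemma vdm_shift o s : vdm (map (addn o) s) = vdm s.
Proof.
elim: s => //= x s ->; rewrite big_map; congr (_ * _)%N.
by apply: eq_bigr => y _; rewrite distnDl.
Qed.

Lemma bases_cat ds ds' : bases (ds ++ ds') = bases ds ++ bases ds'.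
Proof. by rewrite /bases map_cat flatten_cat. Qed.

Lemma bases_unit (s : seq nat) : bases [seq (x, 1%N) | x <- s] = s.
Proof. by elim: s => //= x s; rewrite /bases /= => ->. Qed.

Lemma in_tris_cat ds ds' T : in_tris (ds ++ ds') T = in_tris ds T || in_tris ds' T.
Proof. by rewrite /in_tris /tris map_cat has_cat. Qed.

Lemma in_tris_unit (s : seq nat) i j b : in_tris [seq (x, 1%N) | x <- s] (i, j, b) =
  [&& b, j == 0 & i \in map Posz s].
Proof.
apply/in_trisP/and3P => [[d /mapP[x xs ->] /=]|[-> /eqP -> /mapP[x xs ->]]].
  case: b => h; last by lia.
  have -> : i = x%:Z by lia.
  by split=> //; [lia | rewrite mem_Posz].
by exists (x, 1%N); rewrite /= ?addr0 ?lexx //; apply: map_f.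
Qed.

Lemma in_tris_base ds (i : nat) : in_tris ds (i%:Z, 0, true) = (i \in bases ds).
Proof.
apply/in_trisP/mem_bases => -[d dds h]; exists d => //; lia.
Qed.

Lemma mem_remove_tris e n ds T : (T \in remove (trapezoid e n) (tris ds)) =
  (T \in trapezoid e n) && ~~ in_tris ds T.
Proof. exact: mem_sep. Qed.

(* A vertical lozenge through the line acts as a dent of size 1; s lists the
   positions of these lozenges and o is the position of the left end of the base. *)
Lemma M_half e n o ds (s : seq nat) z :
  all (fun d => d.2 <= n)%N ds -> all (gtn (n + e)%N) (bases ds) ->
  (size (bases ds) + z = n)%N -> uniq (map (addn o) (bases ds) ++ s) ->
  all (fun x => o <= x < o + n + e)%N s -> (0 < n)%N || nilp s ->
  (M (remove (trapezoid e n) (tris (ds ++ [seq ((x - o)%N, 1%N) | x <- s])))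
    * hyperfact n =
   if size s == z then vdm (map (addn o) (bases ds) ++ s) else 0)%N.
Proof.
move=> hn hb hz u hs hnil.
have e1 : [seq ((x - o)%N, 1%N) | x <- s] = [seq (x, 1%N) | x <- map (subn^~ o) s].
  by rewrite -map_comp.
have e2 : map (addn o) (map (subn^~ o) s) = s.
  by rewrite -map_comp map_id_in // => x /(allP hs) /=; lia.
have eb : map (addn o) (bases (ds ++ [seq ((x - o)%N, 1%N) | x <- s])) =
    map (addn o) (bases ds) ++ s.
  by rewrite bases_cat map_cat e1 bases_unit e2.
rewrite M_dented.
- rewrite bases_cat e1 bases_unit size_cat !size_map -hz eqn_add2l.
  by rewrite -[vdm (_ ++ map _ _)](vdm_shift o) map_cat e2.
- rewrite all_cat hn all_map /=; case: s hnil {hs u e1 e2 eb} => //= x s.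
  by rewrite orbF => n0; rewrite n0; apply/allP => y _ /=.
- by rewrite -(map_inj_uniq (@addnI o)) eb.
- rewrite bases_cat all_cat hb e1 bases_unit all_map /=.
  by apply: sub_all hs => x /=; lia.
Qed.

(** * Cutting a region along a horizontal line *)

Definition line_cells (X0 h : int) (b : bool) (s : seq nat) : seq utri :=
  [seq (X0 + x%:Z, h, b) | x <- s].

Lemma M_above (R : region) (h X0 : int) e n o ds (s : seq nat) :
  (forall i j b, h <= j -> ((i, j, b) \in R) =
     ((i - X0 - o%:Z, j - h, b) \in remove (trapezoid e n) (tris ds))) ->
  all (leq o) s ->
  M [fset T in [fset T in R | h <= T.1.2] |
       T \notin line_cells X0 h true s]%fset =
  M (remove (trapezoid e n) (tris (ds ++ [seq ((x - o)%N, 1%N) | x <- s]))).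
Proof.
move=> hup os; symmetry; apply: (@M_shift (X0 + o%:Z) h) => -[[i j] b].
rewrite [shift _ _ _]/= [LHS]mem_sep [X in X && _]mem_sep [RHS]mem_remove_tris /=.
have -> : ((i + (X0 + o%:Z), j + h, b) \in line_cells X0 h true s) =
    in_tris [seq ((x - o)%N, 1%N) | x <- s] (i, j, b).
  have -> : [seq ((x - o)%N, 1%N) | x <- s] = [seq (x, 1%N) | x <- map (subn^~ o) s].
    by rewrite -map_comp.
  rewrite in_tris_unit; apply/mapP/and3P.
    move=> [x xs [e1 e2 ->]]; split=> //.
      by rewrite -(inj_eq (addIr h)) e2 add0r.
    apply/mapP; exists (x - o)%N; first by apply: map_f.
    by have /= ox := allP os _ xs; clear -e1 ox; lia.
  move=> [-> /eqP -> /mapP[m /mapP[x xs ->] ->]]; exists x => //.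
  have /= ox := allP os _ xs; rewrite add0r; congr (_, _, _).
  by clear -ox; lia.
rewrite in_tris_cat negb_or andbA; congr (_ && _).
have [j0|j0] := leP 0 j; last first.
  have j0' : (0 <= j) = false by rewrite leNgt j0.
  by rewrite lerDr mem_trapezoid j0' !andbF.
rewrite lerDr j0 andbT hup ?lerDr // mem_remove_tris addrK.
by rewrite (_ : i + (X0 + o%:Z) - X0 - o%:Z = i) //; clear; lia.
Qed.

(** The lower half is reflected, so that its dents point up too: a down triangle at level [h - 1]
    becomes an up triangle on the base. *)
Lemma M_below (R : region) (h X0 : int) e n o ds (s : seq nat) :
  (forall i j b, j < h -> ((i, j, b) \in R) =
     ((i + j + (- h - X0 - o%:Z) + (if b then 0 else 1), h - 1 - j, ~~ b)
        \in remove (trapezoid e n) (tris ds))) ->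
  all (leq o) s ->
  M [fset T in [fset T in R | T.1.2 < h] |
       T \notin line_cells X0 (h - 1)%R false s]%fset =
  M (remove (trapezoid e n) (tris (ds ++ [seq ((x - o)%N, 1%N) | x <- s]))).
Proof.
move=> hlow os; apply: (@M_flip (- h - X0 - o%:Z) (h - 1)) => -[[i j] b].
rewrite [RHS]mem_sep [X in _ = X && _]mem_sep [LHS]mem_remove_tris.
have -> : ((i, j, b) \in line_cells X0 (h - 1) false s) =
    in_tris [seq ((x - o)%N, 1%N) | x <- s] (flip (- h - X0 - o%:Z) (h - 1) (i, j, b)).
  have -> : [seq ((x - o)%N, 1%N) | x <- s] = [seq (x, 1%N) | x <- map (subn^~ o) s].
    by rewrite -map_comp.
  rewrite in_tris_unit; apply/mapP/and3P.
    move=> [x xs [-> -> ->]]; split=> //; first by rewrite subrr.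
    apply/mapP; exists (x - o)%N; first by apply: map_f.
    by have /= ox := allP os _ xs; clear -ox; lia.
  move=> [hb /eqP ej /mapP[m /mapP[x xs ->] ei]].
  case: b hb ei ej => //= _ ei ej; exists x => //.
  have /= ox := allP os _ xs; congr (_, _, _); clear -ox ej ei; lia.
rewrite in_tris_cat negb_or andbA; congr (_ && _); rewrite /flip /=.
have [j0|j0] := ltP j h; last first.
  rewrite mem_trapezoid (_ : (0 <= h - 1 - j) = false) ?andbF //.
  by clear -j0; lia.
by rewrite andbT hlow // mem_remove_tris.
Qed.

(** Common form of the cut for both regions; [o] and [o'] are the starts of the two bases on the
    line. By the [perm_eq] hypothesis each position outside the gaps is a dent of exactly one half,
    so a crossing position sees each of them once in total, which gives [gap_sum]. *)
Lemma M_line (R : region) (h X0 : int) p g1 c g2 q z e n o ds e' n' o' ds' :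
  (forall i j b, h <= j -> ((i, j, b) \in R) =
     ((i - X0 - o%:Z, j - h, b) \in remove (trapezoid e n) (tris ds))) ->
  (forall i j b, j < h -> ((i, j, b) \in R) =
     ((i + j + (- h - X0 - o'%:Z) + (if b then 0 else 1), h - 1 - j, ~~ b)
        \in remove (trapezoid e' n') (tris ds'))) ->
  all (fun d => d.2 <= n)%N ds -> all (gtn (n + e)%N) (bases ds) ->
  (size (bases ds) + z = n)%N ->
  (o <= p)%N -> (p + g1 + c + g2 <= o + n + e <= p + g1 + c + g2 + q)%N ->
  all (fun d => d.2 <= n')%N ds' -> all (gtn (n' + e')%N) (bases ds') ->
  (size (bases ds') + z = n')%N ->
  (o' <= p)%N -> (p + g1 + c + g2 <= o' + n' + e' <= p + g1 + c + g2 + q)%N ->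
  perm_eq (map (addn o) (bases ds) ++ map (addn o') (bases ds'))
    (three_intervals p g1 c g2 q) ->
  (M R * hyperfact n * hyperfact n' =
    vdm (bases ds) * vdm (bases ds') * gap_sum p g1 c g2 q z)%N.
Proof.
move=> hup hlow dn bn zn op on dn' bn' zn' op' on' hperm.
pose pos (k : 'I_(g1 + g2)) := gap_pos p c k.
pose d k : utri := (X0 + (pos k)%:Z, h - 1, false).
pose u k : utri := (X0 + (pos k)%:Z, h, true).
pose A : region := [fset T in R | T.1.2 < h]%fset.
pose B : region := [fset T in R | h <= T.1.2]%fset.
pose U := map (addn o) (bases ds); pose W := map (addn o') (bases ds').
have pos_inj : injective pos by exact: gap_pos_inj.
have posb k : (p <= pos k < p + g1 + c + g2)%N by apply: gap_pos_bounds.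
have pos_out k : pos k \notin three_intervals p g1 c g2 q.
  have lt : (pos k < p + g1 + c + g2 + q)%N by have := posb k; lia.
  by apply/(gap_posP lt); exists k.
have posU k : pos k \notin U.
  by apply: contra (pos_out k) => h1; rewrite -(perm_mem hperm) mem_cat h1.
have posW k : pos k \notin W.
  by apply: contra (pos_out k) => h1; rewrite -(perm_mem hperm) mem_cat h1 orbT.
have uUW : uniq (U ++ W) by rewrite (perm_uniq hperm) uniq_three_intervals.
have uU : uniq U by move: uUW; rewrite cat_uniq => /and3P[].
have uW : uniq W by move: uUW; rewrite cat_uniq => /and3P[].
have uB k : (u k \in B) = (0 < n)%N.
  rewrite mem_sep /= lexx andbT hup // mem_remove_tris.
  have -> : X0 + (pos k)%:Z - X0 - o%:Z = (pos k - o)%N%:Z by have := posb k; lia.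
  rewrite subrr in_tris_base mem_trapezoid (_ : _ \notin _); last first.
    apply: contra (posU k) => hk; apply/mapP; exists (pos k - o)%N => //.
    by have := posb k; lia.
  by have := posb k; lia.
have dA k : (d k \in A) = (0 < n')%N.
  rewrite mem_sep hlow; last by rewrite ltrBlDr ltrDl.
  rewrite mem_remove_tris [(d k).1.2 < h]/=.
  have -> : X0 + (pos k)%:Z + (h - 1) + (- h - X0 - o'%:Z) + 1 = (pos k - o')%N%:Z.
    by have := posb k; lia.
  rewrite subrr in_tris_base mem_trapezoid (_ : _ \notin _); last first.
    apply: contra (posW k) => hk; apply/mapP; exists (pos k - o')%N => //.
    by have := posb k; lia.
  by have := posb k; rewrite /=; lia.
have -> : R = (A `|` B)%fset.
  by apply/fsetP => T; rewrite in_fsetU !mem_sep ltNge -andb_orr orNb andbT.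
rewrite (@M_cut _ d u).
- rewrite -mulnA big_distrl /= /gap_sum big_distrr /=.
  rewrite big_mkcond [RHS]big_mkcond; apply: eq_bigr => V _.
  set sV := [seq gap_pos p c k | k in V].
  have sizeV : size sV = #|V| by rewrite size_image.
  have usV : uniq sV by rewrite map_inj_uniq ?enum_uniq.
  have posV x : x \in sV -> exists2 k, k \in V & x = pos k by move=> /imageP.
  have condE : [forall k in V, (d k \in A) && (u k \in B)] =
      (V == set0) || (0 < n')%N && (0 < n)%N.
    have [->|[k0 k0V]] := set_0Vmem V.
      by rewrite eqxx; apply/forallP => k; rewrite inE.
    have -> : (V == set0) = false by apply/negP => /eqP e0; rewrite e0 inE in k0V.
    apply/forallP/idP => [/(_ k0)|/= hn k]; first by rewrite k0V /= dA uB.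
    by rewrite dA uB hn implybT.
  (* An excluded [V] is nonempty while one half has height 0. As [z] is at most either height, its
     size differs from [z], and [gap_sum] omits it too. *)
  rewrite condE; case: ifP => [hn|/negbT hn]; last first.
    case: ifP => // /eqP cV; move: hn; rewrite -cards_eq0 cV negb_or.
    by rewrite -lt0n -zn -zn'; clear; lia.
  have osV : all (leq o) sV.
    by apply/allP => x /posV[k _ ->]; apply: leq_trans op _; case/andP: (posb k).
  have osV' : all (leq o') sV.
    by apply/allP => x /posV[k _ ->]; apply: leq_trans op' _; case/andP: (posb k).
  have -> : [seq d k | k in V] = line_cells X0 (h - 1) false sV.
    by rewrite /line_cells -map_comp.
  have -> : [seq u k | k in V] = line_cells X0 h true sV.
    by rewrite /line_cells -map_comp.
  rewrite (M_above hup osV) (M_below hlow osV').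
  rewrite [(hyperfact n * _)%N]mulnC mulnACA.
  have uUV : uniq (U ++ sV).
    rewrite cat_uniq uU usV andbT; apply/hasPn => x /posV[k _ ->]; exact: posU.
  have uWV : uniq (W ++ sV).
    rewrite cat_uniq uW usV andbT; apply/hasPn => x /posV[k _ ->]; exact: posW.
  have hsV : all (fun x => o <= x < o + n + e)%N sV.
    apply/allP => x /posV[k _ ->]; have := posb k; move: op on; clear; lia.
  have hsV' : all (fun x => o' <= x < o' + n' + e')%N sV.
    apply/allP => x /posV[k _ ->]; have := posb k; move: op' on'; clear; lia.
  have [nV nV'] : ((0 < n)%N || nilp sV) /\ ((0 < n')%N || nilp sV).
    by rewrite /nilp sizeV cards_eq0; case/orP: hn => [->|/andP[-> ->]]; rewrite ?orbT.
  rewrite (M_half dn bn zn uUV hsV nV) (M_half dn' bn' zn' uWV hsV' nV') sizeV.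
  case: ifP => // _; rewrite !vdm_cat !vdm_shift -(perm_big _ hperm) /= big_cat /=.
  rewrite expnS expn1; move: (vdm sV) (vdm (bases ds)) (vdm (bases ds')).
  move: (\prod_(x <- _) _)%N (\prod_(x <- map (addn o') _) _)%N; clear.
  by intros; ring.

- by move=> k k' [] /addrI [] /pos_inj.
- by move=> k k' [] /addrI [] /pos_inj.
- apply/fdisjointP => T; rewrite mem_sep => /andP[_ lt].
  by rewrite mem_sep negb_and leNgt lt orbT.
- by move=> k; rewrite share_edgeE subrK !eqxx /= !orbT.
(* Both triangles of a straddling pair survive in their halves, so their position is a dent of
   neither half, that is, a gap position. *)
- case=> [[i j] b] [[i' j'] b']; rewrite mem_sep [X in _ -> is_true X -> _]mem_sep /=.
  move=> /andP[TR ltj] /andP[TR' lej]; rewrite share_edgeE => adj.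
  have [eb eb' ej ej' ei] : [/\ b = false, b' = true, j = h - 1, j' = h & i' = i].
    by move: adj ltj lej; clear; case: b; case: b' => //=; split=> //; lia.
  move: TR TR'; rewrite {}eb {}eb' {}ej {}ej' {}ei {adj ltj lej}.
  rewrite (hup _ _ true) // (hlow _ _ false); last by rewrite ltrBlDr ltrDl.
  rewrite !mem_remove_tris !subrr (_ : i + _ + _ + 1 = i - X0 - o'%:Z); last by clear; lia.
  rewrite !mem_trapezoid [~~ false]/= => /andP[/and4P[h1 _ _ h2] nW] /andP[/and4P[h3 _ _ h4] nU].
  have [m em] : exists m : nat, i = X0 + m%:Z.
    have [|m em] := @int_nonneg_nat (i - X0); first by clear -h1; lia.
    by exists m; rewrite -em addrC subrK.
  have lt : (m < p + g1 + c + g2 + q)%N by clear -em h4 on; lia.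
  have : m \notin three_intervals p g1 c g2 q.
    rewrite -(perm_mem hperm) mem_cat negb_or; apply/andP; split.
      apply: contra nU => /mapP[m' m'U e1].
      by rewrite (_ : i - X0 - o%:Z = m'%:Z) ?in_tris_base //; clear -em e1; lia.
    apply: contra nW => /mapP[m' m'W e1].
    by rewrite (_ : i - X0 - o'%:Z = m'%:Z) ?in_tris_base //; clear -em e1; lia.
  by move=> /(gap_posP lt)[k ek]; exists k; rewrite em ek.
Qed.

(** * Mirror symmetry of the sum over crossings *)

Lemma vdm_mirror N s : all (gtn N) s -> vdm (map (fun x => N.-1 - x)%N s) = vdm s.
Proof.
elim: s => //= x s IH /andP[xN sN]; rewrite IH // big_map; congr (_ * _)%N.
by apply: eq_big_seq => y /(allP sN) /= yN; lia.
Qed.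

Lemma mem_mirror N (s : seq nat) x : all (gtn N) s ->
  (x \in map (fun x => N.-1 - x)%N s) = (x < N)%N && ((N.-1 - x)%N \in s).
Proof.
move=> sN; apply/mapP/andP => [[y ys ->]|[xN xs]].
  have /= yN := allP sN _ ys; split; first lia.
  by rewrite (_ : (N.-1 - (N.-1 - y))%N = y) //; lia.
by exists (N.-1 - x)%N => //; lia.
Qed.

Lemma uniq_mirror N (s : seq nat) : all (gtn N) s -> uniq s ->
  uniq (map (fun x => N.-1 - x)%N s).
Proof.
move=> sN us; rewrite map_inj_in_uniq // => x y /(allP sN) /= h1 /(allP sN) /= h2.
lia.
Qed.

(** Only distances occur, and the map x -> N - 1 - x preserves them while reversing the order of the
    segments. *)
Lemma gap_sum_mirror p g1 c g2 q z : gap_sum p g1 c g2 q z = gap_sum q g2 c g1 p z.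
Proof.
pose N := (p + g1 + c + g2 + q)%N.
pose f (k : 'I_(g1 + g2)) : 'I_(g2 + g1) := cast_ord (addnC g1 g2) (rev_ord k).
pose f' (k : 'I_(g2 + g1)) : 'I_(g1 + g2) := cast_ord (addnC g2 g1) (rev_ord k).
have fK : cancel f f' by move=> k; apply: val_inj => /=; have := ltn_ord k; lia.
have f'K : cancel f' f by move=> k; apply: val_inj => /=; have := ltn_ord k; lia.
have injf := can_inj fK.
have fpos k : gap_pos q c (f k) = (N.-1 - gap_pos p c k)%N.
  by rewrite /gap_pos /N /=; have := ltn_ord k; case: ifP; case: ifP; lia.
rewrite /gap_sum [RHS](reindex (fun V : {set 'I_(g1 + g2)} => f @: V)) /=; last first.
  exists (fun V : {set 'I_(g2 + g1)} => f' @: V) => V _; apply/setP => k.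
    by rewrite -{1}(fK k) !mem_imset //; exact: can_inj f'K.
  by rewrite -{1}(f'K k) !mem_imset //; exact: can_inj f'K.
apply: eq_big => [V|V _]; first by rewrite card_imset.
set s := [seq gap_pos p c k | k in V].
have sN : all (gtn N) s.
  apply/allP => x /imageP[k _ ->] /=; have := gap_pos_bounds p c k.
  by rewrite /N; lia.
have us : uniq s by rewrite map_inj_uniq ?enum_uniq //; exact: gap_pos_inj.
have ps : perm_eq [seq gap_pos q c k | k in f @: V] (map (fun x => N.-1 - x)%N s).
  apply: uniq_perm; rewrite ?uniq_mirror //.
    by rewrite map_inj_uniq ?enum_uniq //; exact: gap_pos_inj.
  move=> x; apply/imageP/mapP => [[k' /imsetP[k kV ->] ->]|[y /imageP[k kV ->] ->]].
    by exists (gap_pos p c k); [apply: image_f | rewrite fpos].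
  by exists (f k); [apply: imset_f | rewrite fpos].
have tN : all (gtn N) (three_intervals p g1 c g2 q).
  by apply/allP => x; rewrite !mem_cat !mem_iota /= /N; lia.
have pt : perm_eq (three_intervals q g2 c g1 p)
    (map (fun x => N.-1 - x)%N (three_intervals p g1 c g2 q)).
  apply: uniq_perm; rewrite ?uniq_mirror ?uniq_three_intervals // => x.
  by rewrite mem_mirror // !mem_cat !mem_iota /N; lia.
rewrite (vdm_perm ps) (vdm_mirror sN) (perm_big _ pt) /= big_map; congr (_ * _)%N.
apply: eq_big_seq => y /(allP tN) /= yN.
rewrite (perm_big _ ps) [RHS]big_map; apply: eq_big_seq => x /(allP sN) /= xN.
by lia.
Qed.

(** * Ferns as lists of dents *)

(** For a fern starting with an up-pointing triangle, [true] gives its dents in the upper half and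
    [false] those in the lower half. *)
Fixpoint fern_tris (up : bool) (p : nat) (t : seq nat) : seq (nat * nat) :=
  if t is t1 :: t' then
    let ds := fern_tris (~~ up) (p + t1) t' in if up then (p, t1) :: ds else ds
  else [::].

Lemma osum_cons x t : osum (x :: t) = (x + esum t)%N.
Proof.
rewrite /osum big_mkcond big_ord_recl /esum [in RHS]big_mkcond /=.
by congr (_ + _)%N; apply: eq_bigr => i _ /=; rewrite negbK.
Qed.

Lemma esum_cons x t : esum (x :: t) = osum t.
Proof.
by rewrite /esum big_mkcond big_ord_recl /osum [in RHS]big_mkcond.
Qed.

Lemma osum_nil : osum [::] = 0%N. Proof. by rewrite /osum big_ord0. Qed.
Lemma esum_nil : esum [::] = 0%N. Proof. by rewrite /esum big_ord0. Qed.

Lemma osum_esum t : (osum t + esum t = sumn t)%N.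
Proof.
elim: t => [|x t IH]; first by rewrite osum_nil esum_nil.
by rewrite osum_cons esum_cons /= -IH; lia.
Qed.

Lemma oesum_cat s t :
  osum (s ++ t) = (osum s + (if odd (size s) then esum t else osum t))%N /\
  esum (s ++ t) = (esum s + (if odd (size s) then osum t else esum t))%N.
Proof.
elim: s => [|x s [IHo IHe]]; first by rewrite osum_nil esum_nil.
rewrite /= !osum_cons !esum_cons IHo IHe addnA.
by case: (odd _).
Qed.

Lemma osum_cat s t :
  osum (s ++ t) = (osum s + (if odd (size s) then esum t else osum t))%N.
Proof. by case: (oesum_cat s t). Qed.

Lemma esum_cat s t :
  esum (s ++ t) = (esum s + (if odd (size s) then osum t else esum t))%N.
Proof. by case: (oesum_cat s t). Qed.

Lemma oesum_rev t :
  osum (rev t) = (if odd (size t) then osum t else esum t) /\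
  esum (rev t) = (if odd (size t) then esum t else osum t).
Proof.
elim: t => [|x t [IHo IHe]]; first by rewrite osum_nil esum_nil.
rewrite rev_cons -cats1 osum_cat esum_cat size_rev IHo IHe !osum_cons !esum_cons.
rewrite osum_nil esum_nil /=; case: (odd _) => /=; lia.
Qed.

Lemma fern_tris_cat up p s t : fern_tris up p (s ++ t) =
  fern_tris up p s ++ fern_tris (up (+) odd (size s)) (p + sumn s) t.
Proof.
elim: s up p => [|x s IH] up p /=; first by rewrite addbF addn0.
by rewrite IH addnA; case: up => /=; rewrite ?addTb ?addFb ?negbK.
Qed.

Lemma bases_cons d ds : bases (d :: ds) = iota d.1 d.2 ++ bases ds.
Proof. by []. Qed.

Lemma size_bases ds : size (bases ds) = sumn (unzip2 ds).
Proof. by elim: ds => //= d ds IH; rewrite bases_cons size_cat size_iota IH. Qed.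

Lemma le_size_bases ds : all (fun d => d.2 <= size (bases ds))%N ds.
Proof.
apply/allP => d dds; rewrite size_bases sumnE big_map (big_rem d) //=.
exact: leq_addr.
Qed.

Lemma size_bases_fern up p t :
  size (bases (fern_tris up p t)) = if up then osum t else esum t.
Proof.
elim: t up p => [|x t IH] up p /=; first by rewrite osum_nil esum_nil; case: up.
by rewrite osum_cons esum_cons; case: up; rewrite ?bases_cons ?size_cat ?size_iota IH.
Qed.

Lemma subseq_bases_fern up p t : subseq (bases (fern_tris up p t)) (iota p (sumn t)).
Proof.
elim: t up p => [|x t IH] up p //=; rewrite iotaD; case: up => /=.
  by rewrite bases_cons; apply: cat_subseq.
by apply: subseq_trans (suffix_subseq _ _); apply: IH.
Qed.

Lemma perm_bases_fern up p t :
  perm_eq (bases (fern_tris up p t) ++ bases (fern_tris (~~ up) p t)) (iota p (sumn t)).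
Proof.
elim: t up p => [|x t IH] up p //=; rewrite iotaD; case: up => /=.
  by rewrite bases_cons -catA perm_cat2l; apply: (IH false).
by rewrite bases_cons perm_catCA perm_cat2l; apply: (IH true).
Qed.

Lemma uniq_bases_fern up p t : uniq (bases (fern_tris up p t)).
Proof. exact: subseq_uniq (subseq_bases_fern up p t) (iota_uniq _ _). Qed.

Lemma bases_fern_lt up p t : all (gtn (p + sumn t)%N) (bases (fern_tris up p t)).
Proof.
apply/allP => x /(mem_subseq (subseq_bases_fern up p t)).
by rewrite mem_iota => /andP[].
Qed.

Lemma bases_fern_shift o up p t :
  bases (fern_tris up (o + p) t) = map (addn o) (bases (fern_tris up p t)).
Proof.
elim: t up p => [|x t IH] up p //=; rewrite -addnA; case: up => //=.
by rewrite !bases_cons /= map_cat -iotaDl IH.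
Qed.

Lemma dents_fern p t : dents p t = tris (fern_tris true p t).
Proof.
have [n] := ubnP (size t); elim: n p t => // n IH p [|t1 [|t2 t]] //= lt.
by rewrite IH //; lia.
Qed.

(** The count of dents is always right here: the height of the semihexagon is [osum t], the total
    length of its dents. *)
Lemma s_vdm t :
  (s t * hyperfact (osum t) = vdm (bases (fern_tris true 0 t)))%N.
Proof.
rewrite /s /dented_semihexagon dents_fern M_dented.
- by rewrite size_bases_fern eqxx.
- by have := le_size_bases (fern_tris true 0 t); rewrite size_bases_fern.
- exact: uniq_bases_fern.
- by rewrite osum_esum; apply: bases_fern_lt.
Qed.

Lemma has_fern_above X h up p t i j b : h <= j ->
  has (fun P => inside P (i, j, b)) (fern up (X + p%:Z, h) t) =
  in_tris (fern_tris up p t) (i - X, j - h, b).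
Proof.
move=> hj; elim: t up p => [|x t IH] up p //=.
rewrite -addrA -PoszD IH; case: up => /=.
  by rewrite -[in_tris (_ :: _) _]/(_ || _) /= !inside_up; congr (_ || _); clear IH; case: b; lia.
by rewrite inside_down (_ : (j + 1 <= h) = false) ?andbF //; clear -hj; lia.
Qed.

(** Up-pointing triangles have no cell below the line, and the reflection turns the down-pointing
    ones into dents, hence [~~ up]. *)
Lemma has_fern_below X h up p t i j b : j < h ->
  has (fun P => inside P (i, j, b)) (fern up (X + p%:Z, h) t) =
  in_tris (fern_tris (~~ up) p t)
    (i + j + (- h - X) + (if b then 0 else 1), h - 1 - j, ~~ b).
Proof.
move=> hj; elim: t up p => [|x t IH] up p //=.
rewrite -addrA -PoszD IH; case: up => /=.
  by rewrite inside_up (_ : (h <= j) = false) ?andbF //; clear -hj; lia.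
rewrite -[in_tris (_ :: _) _]/(_ || _) /= inside_down inside_up; congr (_ || _).
by clear IH; case: b => /=; lia.
Qed.

Lemma fern_rcons up P t x : fern up P (rcons t x) =
  rcons (fern up P t) (triangle (up (+) odd (size t)) (P.1 + (sumn t)%:Z, P.2) x).
Proof.
elim: t up P => [|x0 t IH] up [P1 P2] /=; first by rewrite addbF addr0.
by rewrite IH /= PoszD addrA; case: up; rewrite /= ?negbK.
Qed.

(** The leftmost triangle has orientation [up] exactly when the number of triangles is odd. *)
Lemma has_fern_rl (Q : pred (pred point)) up X h t :
  has Q (fern_rl up (X, h) t) =
  has Q (fern (up (+) ~~ odd (size t)) (X - (sumn t)%:Z, h) (rev t)).
Proof.
elim: t up X => [|x t IH] up X //=.
rewrite IH rev_cons fern_rcons has_rcons size_rev /= sumn_rev PoszD opprD addrA.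
by rewrite subrK; case: up; case: (odd (size t)).
Qed.

(** * Closed forms of [vdm] on intervals *)

Lemma vdm_iota o n : vdm (iota o n) = hyperfact n.
Proof.
rewrite -[o]addn0 iotaDl vdm_shift; elim: n => [|n IH].
  by rewrite /hyperfact big_ord0.
rewrite hyperfactS /= -[1%N]addn0 iotaDl vdm_shift IH mulnC; congr (_ * _)%N.
rewrite fact_prod -iotaDl /index_iota subn1 /= addn0.
by apply: eq_bigr => y _; rewrite sub0r abszN.
Qed.

Lemma prod_dist_iota p m :
  (\prod_(x <- iota 0 p) `|x - (p + m)%N| * m`! = (p + m)`!)%N.
Proof.
rewrite -(@ffact_fact (p + m) p) ?leq_addr // addKn; congr (_ * _)%N.
rewrite ffact_prod -{1}[p]subn0 -/(index_iota 0 p) big_mkord.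
by apply: eq_bigr => i _; have := ltn_ord i; lia.
Qed.

(** Evaluates the dents of the upper half of the cored hexagon. A point appended to the second
    interval has distances to the first with product (p + g + c)! / (g + c)!, the ratio by which the
    hyperfactorials grow. *)
Lemma vdm_two_iota p g c :
  (vdm (iota 0 p ++ iota (p + g) c) * (hyperfact (p + g) * hyperfact (c + g)) =
   hyperfact p * hyperfact c * (hyperfact (p + c + g) * hyperfact g))%N.
Proof.
rewrite vdm_cat !vdm_iota -mulnA; congr (_ * _)%N.
elim: c => [|c IH].
  by rewrite addn0 big1 ?mul1n // => x _; rewrite /= big_nil.
have -> : iota (p + g) c.+1 = iota (p + g) c ++ [:: (p + (g + c))%N].
  by rewrite -addn1 iotaD addnA.
under eq_bigr => x _ do rewrite big_cat /= big_cons big_nil muln1.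
rewrite big_split /= addSn addnS addSn !hyperfactS.
have hY := prod_dist_iota p (g + c).
rewrite (addnC c g) in IH *; rewrite -addnA (addnC c g) in IH *.
set X := (\prod_(x <- _) \prod_(y <- _) _)%N in IH *.
set Y := (\prod_(x <- _) _)%N in hY *.
transitivity ((X * (hyperfact (p + g) * hyperfact (g + c))) * (Y * (g + c)`!))%N.
  by ring.
by rewrite IH hY; ring.
Qed.

(** * The arguments of the two factors [s] *)

Section SubstSequences.
Variables (a b c : seq nat) (g g' l r : nat).
Hypotheses (ha : (0 < size a)%N) (ha2 : ~~ odd (size a)).
Hypotheses (hb : (0 < size b)%N) (hb2 : ~~ odd (size b)).
Hypotheses (hc : (0 < size c)%N) (hc2 : ~~ odd (size c)).

(** Odd entries are the dents of the upper half. The last triangle in each sequence points down, so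
    its length merges with the adjacent gap [g'] or [g]. *)
Definition upper_seq : seq nat :=
  take (size a).-1 a ++ [:: (nth 0 a (size a).-1 + g')%N]
  ++ take (size c).-1 c ++ [:: (nth 0 c (size c).-1 + g + nth 0 b (size b).-1)%N]
  ++ rev (take (size b).-1 b).

(** Odd entries are the dents of the lower half, including the end dents [l] and [r]; the
    up-pointing first triangle of the middle fern merges with [g']. *)
Definition lower_seq : seq nat :=
  [:: l] ++ a ++ [:: (g' + nth 0 c 0)%N] ++ drop 1 c ++ [:: g] ++ rev b ++ [:: r].

Lemma upper_seqE : fern_tris true 0 upper_seq =
  fern_tris true 0 a ++ fern_tris true (sumn a + g') c ++
  fern_tris false (sumn a + g' + sumn c + g) (rev b).
Proof.
rewrite /upper_seq; case/lastP: a ha ha2 => // a' am _.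
case/lastP: b hb hb2 => // b' bm _; case/lastP: c hc hc2 => // c' cm _.
rewrite !size_rcons /= !negbK => oc ob oa.
rewrite !nth_rcons !ltnn !eqxx -!cats1 !take_size_cat // !cats1 rev_rcons.
rewrite -!cats1 !fern_tris_cat /= !oa !oc /= !cats0 !sumn_cat /=.
rewrite fern_tris_cat /= oc /=.
by congr (_ ++ (fern_tris _ _ _ ++ fern_tris _ _ _)); lia.
Qed.

Lemma lower_seqE : fern_tris true 0 lower_seq =
  (0%N, l) :: fern_tris false l a ++ fern_tris false (l + sumn a + g') c ++
  fern_tris true (l + sumn a + g' + sumn c + g) (rev b) ++
  [:: ((l + sumn a + g' + sumn c + g + sumn b)%N, r)].
Proof.
rewrite /lower_seq; case: c hc hc2 => // c0 c1 _ /=; rewrite negbK drop0 => oc.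
do 5!rewrite ?fern_tris_cat ?size_rev ?(negbTE ha2) ?(negbTE hb2) ?oc /=.
rewrite sumn_rev.

by congr (_ :: _ ++ (fern_tris _ _ _ ++ (fern_tris _ _ _ ++ [:: (_, _)]))); lia.
Qed.

Lemma osum_upper_seq : osum upper_seq = (osum a + osum b + osum c)%N.
Proof.
have := size_bases_fern true 0 upper_seq; rewrite upper_seqE !bases_cat !size_cat.
rewrite !size_bases_fern => <-; have [_ ->] := oesum_rev b.
by rewrite (negbTE hb2); lia.
Qed.

Lemma osum_lower_seq : osum lower_seq = (l + r + (esum a + esum b + esum c))%N.
Proof.
have := size_bases_fern true 0 lower_seq; rewrite lower_seqE.
rewrite bases_cons !bases_cat !size_cat size_iota.
rewrite !size_bases_fern => <-; have [-> _] := oesum_rev b.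
by rewrite (negbTE hb2) size_iota /=; lia.
Qed.

Lemma sumn_upper_seq : sumn upper_seq = (sumn a + g' + sumn c + g + sumn b)%N.
Proof.
rewrite /upper_seq; case/lastP: a ha => // a' am _.
case/lastP: b hb => // b' bm _; case/lastP: c hc => // c' cm _.
rewrite !size_rcons !nth_rcons !ltnn !eqxx -!cats1 !take_size_cat //.
by rewrite !sumn_cat /= sumn_rev; lia.
Qed.

Lemma sumn_lower_seq :
  sumn lower_seq = (l + sumn a + g' + sumn c + g + sumn b + r)%N.
Proof.
rewrite /lower_seq; case: c hc => // c0 c1 _.
by rewrite !sumn_cat /= drop0 sumn_rev; lia.
Qed.

(** The upper base starts where the end dent [l] of the lower one stops, hence the shift by [l]. *)
Lemma perm_upper_lower_seq :
  perm_eq (map (addn l) (bases (fern_tris true 0 upper_seq)) ++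
           bases (fern_tris true 0 lower_seq))
    (three_intervals (l + sumn a) g' (sumn c) g (sumn b + r)).
Proof.
rewrite upper_seqE lower_seqE !bases_cat !map_cat -!bases_fern_shift !bases_cons.
rewrite !bases_cat bases_cons /three_intervals addn0 !addnA cats0 !iotaD add0n.
set aU := bases (fern_tris true l a); set aD := bases (fern_tris false l a).
set cU := bases (fern_tris true _ c); set cD := bases (fern_tris false _ c).
set bU := bases (fern_tris false _ _); set bD := bases (fern_tris true _ (rev b)).
have pa : perm_eq (iota l (sumn a)) (aU ++ aD).
  by rewrite perm_sym; apply: perm_bases_fern.
have pc : perm_eq (iota (l + sumn a + g') (sumn c)) (cU ++ cD).
  by rewrite perm_sym; apply: perm_bases_fern.
have pb : perm_eq (iota (l + sumn a + g' + sumn c + g) (sumn b)) (bU ++ bD).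
  by rewrite perm_sym -(sumn_rev b); apply: (perm_bases_fern false).
apply/permP => P.
move/permP: pa => /(_ P); move/permP: pb => /(_ P); move/permP: pc => /(_ P).
by rewrite !count_cat /=; lia.
Qed.

End SubstSequences.

(** * The region with three ferns, cut along their line *)

Lemma in_tris_cons d ds i j b : in_tris (d :: ds) (i, j, b) =
  [&& d.1%:Z <= i, 0 <= j & i + j + (if b then 1 else 2) <= d.1%:Z + d.2%:Z]
  || in_tris ds (i, j, b).
Proof. by rewrite -[LHS]/(_ || _) /= inside_up addr0. Qed.

Lemma in_tris_nil T : in_tris [::] T = false.
Proof. by []. Qed.

Section Qregion.
Variables (x z : nat) (y : int) (a b c : seq nat) (l r : nat).
Hypotheses (ha : (0 < size a)%N) (ha2 : ~~ odd (size a)).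
Hypotheses (hb : (0 < size b)%N) (hb2 : ~~ odd (size b)).
Hypotheses (hc : (0 < size c)%N) (hc2 : ~~ odd (size c)).
(** [l] and [r] are the numbers of rows from the line down to the west and east vertices; they
    remain natural numbers in the case [y = -1]. *)
Hypothesis hl : y + (sumn b - sumn a)%N%:Z = l%:Z.
Hypothesis hr : y + (sumn a - sumn b + 1)%N%:Z = r%:Z.
Let O := (osum a + osum b + osum c)%N.
Let E := (esum a + esum b + esum c)%N.
Let g := half (x + z)%N.
Let g' := uphalf (x + z)%N.
Let h := (r + l + z + E)%N.

(** Expressing the sides by [l] and [r] removes [y]; the right fern, read from left to right, starts
    with a down-pointing triangle. *)
Lemma mem_Qregion i j b0 : ((i, j, b0) \in Qregion x y z a c b) =
  [&& 0 <= j, j + 1 <= (h + z + O)%N%:Z, - (r + z + E)%N%:Z <= i,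
      i + 1 <= (x + O)%N%:Z, 0 <= i + j + (if b0 then 0 else 1)
    & i + j + (if b0 then 1 else 2) <= (x + O + l + z + E)%N%:Z] &&
  ~~ [|| has (fun P => inside P (i, j, b0))
           (fern true (- h%:Z + l%:Z, h%:Z) a),
         has (fun P => inside P (i, j, b0))
           (fern true (- h%:Z + (l + sumn a + g')%N%:Z, h%:Z) c)
       | has (fun P => inside P (i, j, b0))
           (fern false (- h%:Z + (l + sumn a + g' + sumn c + g)%N%:Z, h%:Z) (rev b))].
Proof.
have sa := osum_esum a; have sb := osum_esum b; have sc := osum_esum c.
rewrite /Qregion /=.
have -> : absz (y + (z + (osum a + osum b + osum c) + (sumn a - sumn b) + 1)%N%:Z)
   = (r + z + O)%N by move: hr; rewrite /O; clear; lia.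
have -> : absz (y + (z + (esum a + esum b + esum c) + (sumn b - sumn a))%N%:Z)
   = (l + z + E)%N by move: hl; rewrite /E; clear; lia.
have -> : absz (y + (z + (esum a + esum b + esum c) + (sumn a - sumn b) + 1)%N%:Z)
   = (r + z + E)%N by move: hr; rewrite /E; clear; lia.
rewrite -/O -/E.
have -> : (r + z + O + (l + z + E))%N%:Z - (z + O)%N%:Z = h%:Z.
  by rewrite /h; clear; lia.
have -> : - (r + z + E)%N%:Z + (sumn a + uphalf (x + z))%N%:Z =
    - h%:Z + (l + sumn a + g')%N%:Z by rewrite /h /g'; clear; lia.
rewrite [LHS]mem_sep mem_hexagon; last by clear; lia.
rewrite !has_cat has_fern_rl (negbTE hb2) /=.
have -> : (x + O + (l + z + E))%N%:Z - h%:Z - (sumn b)%:Z =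
    - h%:Z + (l + sumn a + g' + sumn c + g)%N%:Z.
  have e : (g' + g = x + z)%N by rewrite /g' /g uphalf_half -addnA addnn odd_double_half.
  by move: sa sb sc e; rewrite /h /O /E; clear; lia.
have -> : - (r + z + E)%N%:Z = - h%:Z + l%:Z by rewrite /h; clear; lia.
congr (_ && _); congr [&& _, _, _, _, _ & _].
  by congr (_ <= _); rewrite /h; clear; lia.
by congr (_ <= _); clear; lia.
Qed.

Lemma M_Qregion :
  (M (Qregion x y z a c b) * hyperfact (z + O) * hyperfact h =
   vdm (bases (fern_tris true 0 (upper_seq a b c g g'))) *
   vdm (bases (fern_tris true 0 (lower_seq a b c g g' l r))) *
   gap_sum (l + sumn a) g' (sumn c) g (sumn b + r) z)%N.
Proof.
have sa := osum_esum a; have sb := osum_esum b; have sc := osum_esum c.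
have eg : (g' + g = x + z)%N by rewrite /g' /g uphalf_half -addnA addnn odd_double_half.
(* The extended southwest side meets the line at (-h, h), the origin of positions; [x + E] and
   [x + O] are the north and south sides. *)
apply: (@M_line _ h%:Z (- h%:Z) _ _ _ _ _ _ (x + E) _ l _ (x + O) _ 0).
- move=> i j b0 hj; rewrite mem_Qregion mem_remove_tris mem_trapezoid.
  rewrite upper_seqE // !in_tris_cat.
  have -> : - h%:Z + l%:Z = (- h%:Z + l%:Z) + 0%N%:Z by rewrite addr0.
  have -> : - h%:Z + (l + sumn a + g')%N%:Z = (- h%:Z + l%:Z) + (sumn a + g')%N%:Z.
    by clear; lia.
  have -> : - h%:Z + (l + sumn a + g' + sumn c + g)%N%:Z =
      (- h%:Z + l%:Z) + (sumn a + g' + sumn c + g)%N%:Z by clear; lia.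
  rewrite !has_fern_above //.
  have -> : i - (- h%:Z + l%:Z) = i - - h%:Z - l%:Z by clear; lia.
  congr (_ && _); move: hj; rewrite /h; clear; case: b0; lia.
- move=> i j b0 hj; rewrite mem_Qregion mem_remove_tris mem_trapezoid.
  rewrite lower_seqE // in_tris_cons !in_tris_cat in_tris_cons in_tris_nil orbF.
  rewrite !has_fern_below // [~~ true]/= [~~ false]/=.
  have -> : - h%:Z - - h%:Z - 0%N%:Z = - h%:Z - - h%:Z by rewrite subr0.
  move: (in_tris _ _) (in_tris _ _) (in_tris _ _) => u v w.
  rewrite !negb_or; move: hj sa sb sc eg; rewrite /h /O /E; clear.
  case: w; rewrite ?andbF //; case: v; rewrite ?andbF //; case: u; rewrite ?andbF //=.
  by case: b0 => /=; lia.
- have := le_size_bases (fern_tris true 0 (upper_seq a b c g g')).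
  rewrite size_bases_fern osum_upper_seq // -/O => hh.
  by apply: sub_all hh => d /=; lia.
- have := bases_fern_lt true 0 (upper_seq a b c g g'); rewrite add0n sumn_upper_seq //.
  by rewrite (_ : (_ + sumn b = z + O + (x + E))%N) //; move: sa sb sc eg; rewrite /O /E; clear; lia.
- by rewrite size_bases_fern osum_upper_seq // addnC.
- by rewrite leq_addr.
- by move: sa sb sc eg; rewrite /O /E; clear; lia.
- have := le_size_bases (fern_tris true 0 (lower_seq a b c g g' l r)).
  rewrite size_bases_fern osum_lower_seq // -/E => hh.
  by apply: sub_all hh => d /=; rewrite /h; lia.
- have := bases_fern_lt true 0 (lower_seq a b c g g' l r); rewrite add0n sumn_lower_seq //.
  by rewrite (_ : (_ + r = h + (x + O))%N) //; move: sa sb sc eg; rewrite /h /O /E; clear; lia.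
- by rewrite size_bases_fern osum_lower_seq // /h /E; clear; lia.
- by [].
- by move: sa sb sc eg; rewrite /h /O /E; clear; lia.
- rewrite (eq_map add0n) map_id; exact: perm_upper_lower_seq.
Qed.
End Qregion.

(** * The cored hexagon, cut along the base of its core *)

(** The second parameter has the parity of [x], so [z] is the exception and the vertex lies half a
    unit southwest of the center. *)
Lemma core_vertex_odd x z p : odd x != odd z ->
  core_vertex x (2 * p + z + 1)%N z = ((half (x + z)%N)%:Z - z%:Z - p%:Z, z%:Z + p%:Z).
Proof.
move=> hxz; have hx : odd x = ~~ odd z by move: hxz; case: (odd x); case: (odd z).
have e := odd_double_half (x + z); rewrite oddD hx addNb addbb in e.
have hY : odd (2 * p + z + 1)%N = ~~ odd z.
  by rewrite addn1 /= mul2n oddD odd_double.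
rewrite /core_vertex /core_vertex2 hY hx eqxx.
rewrite (_ : (~~ odd z == odd z) = false) /=; last by case: (odd z).
by congr (_, _); lia.
Qed.

(** The line has level [z + p], with the west vertex [p.+1] rows above and the east vertex [p] rows
    below. The left end dent therefore belongs to the upper half and the right one to the lower
    half. *)
Lemma M_cored x z p C : odd x != odd z ->
  let g := half (x + z)%N in let g' := uphalf (x + z)%N in
  (M (cored_hexagon x (2 * p + z + 1) z C)
     * hyperfact (p.+1 + C + z) * hyperfact (p + z) =
   vdm (iota 0 p.+1 ++ iota (p.+1 + g) C) * hyperfact p *
   gap_sum p.+1 g C g' p z)%N.
Proof.
move=> hxz g g'; rewrite -(vdm_iota (x + z + C) p).
have eg : (g' + g = x + z)%N.
  by rewrite /g' /g uphalf_half -addnA addnn odd_double_half.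
have b1 : bases [:: (0, p.+1); (p.+1 + g, C)]%N = iota 0 p.+1 ++ iota (p.+1 + g) C.
  by rewrite !bases_cons /= cats0.
have b2 : bases [:: (x + z + C, p)]%N = iota (x + z + C) p.
  by rewrite !bases_cons /= cats0.
rewrite -b1 -b2.
apply: (@M_line _ (z + p)%N%:Z (- (2 * p + z + 1)%N%:Z) _ _ _ _ _ _ x _ 0 _ (x + C) _ p.+1).
- move=> i j b0 hj; rewrite [LHS]mem_sep mem_hexagon; last by clear; lia.
  rewrite mem_remove_tris mem_trapezoid !in_tris_cons in_tris_nil orbF /= orbF.
  rewrite core_vertex_odd // inside_up -/g; move: hj; clear; case: b0 => /= hj.
    by apply/idP/idP; lia.
  by apply/idP/idP; lia.
- move=> i j b0 hj; rewrite [LHS]mem_sep mem_hexagon; last by clear; lia.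
  rewrite mem_remove_tris mem_trapezoid !in_tris_cons in_tris_nil orbF /= orbF.
  rewrite core_vertex_odd // inside_up -/g; move: hj; clear; case: b0 => /= hj.
    by apply/idP/idP; lia.
  by apply/idP/idP; lia.
- by rewrite /= andbT; apply/andP; split; lia.
- by rewrite b1; apply/allP => i; rewrite mem_cat !mem_iota /=; move: eg; clear; lia.
- by rewrite b1 size_cat !size_iota.
- by [].
- by move: eg; clear; lia.
- by rewrite /= andbT leq_addr.
- by rewrite b2; apply/allP => i; rewrite mem_iota /=; clear; lia.
- by rewrite b2 size_iota.
- by [].
- by move: eg; clear; lia.
- rewrite b1 b2 (eq_map add0n) map_id -iotaDl -catA.
  by rewrite /three_intervals (_ : (p.+1 + (x + z + C) = p.+1 + g + C + g')%N) //; move: eg; clear; lia.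
Qed.

(** * Elimination of the sum over crossings *)

Lemma hyperfact_neq0 n : (hyperfact n)%:R != 0 :> rat.
Proof.
rewrite pnatr_eq0 /hyperfact -lt0n prodn_gt0 // => i; exact: fact_gt0.
Qed.

Theorem theorem2p9 (x z : nat) (y : int) (a b c : seq nat)
    (hxz : odd x != odd z)
    (ha : (0 < size a)%N) (ha2 : ~~ odd (size a))
    (hb : (0 < size b)%N) (hb2 : ~~ odd (size b))
    (hc : (0 < size c)%N) (hc2 : ~~ odd (size c))
    (hy : -1 <= y) (hy1 : y = -1 -> (sumn a < sumn b)%N) :
  let A := sumn a in let B := sumn b in let C := sumn c in
  let g := half (x + z) in let g' := uphalf (x + z) in
  let mu := maxn A B in let nu := minn A B in
  let D := absz (A%:Z - B%:Z)%R in
  let O := (osum a + osum b + osum c)%N in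
  let E := (esum a + esum b + esum c)%N in
  let H (n : int) : rat := (hyperfact (absz n))%:R in
  let m := size a in let n := size b in let k := size c in
  (M (Qregion x y z a c b))%:R =
    (M (cored_hexagon x (absz (2 * y + (z + 2 * mu + 1)%N%:Z)) z C))%:R
    * (s (take m.-1 a ++ [:: (nth 0 a m.-1 + g')%N]
          ++ take k.-1 c ++ [:: (nth 0 c k.-1 + g + nth 0 b n.-1)%N]
          ++ rev (take n.-1 b)))%:R
    * (s ([:: absz (y + (B - nu)%N%:Z)] ++ a
          ++ [:: (g' + nth 0 c 0)%N] ++ drop 1 c ++ [:: g] ++ rev b
          ++ [:: absz (y + (A - nu + 1)%N%:Z)]))%:R
    * (H (C + g)%N%:Z / (H C%:Z * H g%:Z))
    * (H (y + (mu + g')%N%:Z) / H (y + (mu + C + g')%N%:Z))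
    * (H (y + (mu + z)%N%:Z) * H (y + (mu + C + z + 1)%N%:Z)
       / (H (O + z)%N%:Z * H (2 * y + (D + E + z + 1)%N%:Z)))
    * (H O%:Z * H (2 * y + (D + E + 1)%N%:Z)
       / (H (y + mu%:Z) * H (y + (mu + 1)%N%:Z))) :> rat.
Proof.
move=> A B C g g' mu nu D O E H m n k.
(* If y = -1 then a < b, which makes [l], [r] and [p] nonnegative. *)
have [l el] : exists l : nat, y + (B - A)%N%:Z = l%:Z.
  by apply: int_nonneg_nat; rewrite /A /B; lia.
have [r er] : exists r : nat, y + (A - B + 1)%N%:Z = r%:Z.
  by apply: int_nonneg_nat; rewrite /A /B; lia.
have [p ep] : exists p : nat, y + mu%:Z = p%:Z.
  by apply: int_nonneg_nat; rewrite /mu /A /B; lia.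
have lA : (l + A = p)%N by rewrite /mu in ep; lia.
have rB : (B + r = p.+1)%N by rewrite /mu in ep; lia.
have el' : absz (y + (B - nu)%N%:Z) = l by move: el er; rewrite /nu; clear; lia.
have er' : absz (y + (A - nu + 1)%N%:Z) = r by move: el er; rewrite /nu; clear; lia.
have eY : absz (2 * y + (z + 2 * mu + 1)%N%:Z) = (2 * p + z + 1)%N by move: ep; clear; lia.
have gg : g' = g.+1.
  by rewrite /g /g' uphalf_half oddD; case: (odd x) (odd z) hxz => [] [].
rewrite el' er' eY.
have := s_vdm (upper_seq a b c g g'); rewrite osum_upper_seq //.
have := s_vdm (lower_seq a b c g g' l r); rewrite osum_lower_seq //.
rewrite -/O -/E.
rewrite -/(upper_seq a b c g g') -/(lower_seq a b c g g' l r).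
have := M_Qregion x z ha ha2 hb hb2 hc hc2 el er.
(* The intervals here have lengths [p], [C], [p.+1]; reversing them gives the sum of the cored
   hexagon verbatim. *)
rewrite -/O -/E -/A -/B -/C lA rB -/g -/g' gap_sum_mirror.
have := M_cored p C hxz; cbv zeta; rewrite -/g -/g'.
have := vdm_two_iota p.+1 g C.
move: (vdm (iota 0 p.+1 ++ _)) (gap_sum p.+1 g C g' p z) => v0 G.
move: (M (Qregion _ _ _ _ _ _)) (M _) (s _) (s _) (vdm _) (vdm _).
move=> mQ mC s1 s2 v2 v1 h0 hC hQ h2 h1.
have nat2rat (i j : nat) : i = j -> i%:R = j%:R :> rat by move->.
move/nat2rat: h0; move/nat2rat: hC; move/nat2rat: hQ; move/nat2rat: h2; move/nat2rat: h1.
rewrite !natrM /H.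
have -> : absz (C + g)%N = (C + g)%N by [].
have -> : absz (y + (mu + g')%N%:Z) = (p.+1 + g)%N by move: ep; rewrite gg; clear; lia.
have -> : absz (y + (mu + C + g')%N%:Z) = (p.+1 + C + g)%N by move: ep; rewrite gg; clear; lia.
have -> : absz (y + (mu + z)%N%:Z) = (p + z)%N by move: ep; clear; lia.
have -> : absz (y + (mu + C + z + 1)%N%:Z) = (p.+1 + C + z)%N by move: ep; clear; lia.
have -> : absz (2 * y + (D + E + z + 1)%N%:Z) = (r + l + z + E)%N by move: el er; rewrite /D; clear; lia.
have -> : absz (2 * y + (D + E + 1)%N%:Z) = (l + r + E)%N by move: el er; rewrite /D; clear; lia.
have -> : absz (O + z)%N = (z + O)%N by rewrite addnC.
have -> : absz (y + mu%:Z) = p by move: ep; clear; lia.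
have -> : absz (y + (mu + 1)%N%:Z) = p.+1 by move: ep; clear; lia.
have -> : absz C%:Z = C by [].
have -> : absz g%:Z = g by [].
have -> : absz O%:Z = O by [].
move=> h1 h2 hQ hC h0.
move: h1 h2 hQ hC h0.
have nz := hyperfact_neq0.
move: (nz (C + g)%N) (nz C) (nz g) (nz (p.+1 + g)%N) (nz (p.+1 + C + g)%N)
  (nz (p + z)%N) (nz (p.+1 + C + z)%N) (nz (z + O)%N) (nz (r + l + z + E)%N)
  (nz O) (nz (l + r + E)%N) (nz p) (nz p.+1); clear.
move: (hyperfact (C + g))%:R (hyperfact C)%:R (hyperfact g)%:R
  (hyperfact (p.+1 + g))%:R (hyperfact (p.+1 + C + g))%:R (hyperfact (p + z))%:R
  (hyperfact (p.+1 + C + z))%:R (hyperfact (z + O))%:R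
  (hyperfact (r + l + z + E))%:R (hyperfact O)%:R (hyperfact (l + r + E))%:R
  (hyperfact p)%:R (hyperfact p.+1)%:R.
move: (mQ%:R) (mC%:R) (s1%:R) (s2%:R) (v0%:R) (v1%:R) (v2%:R) (G%:R); clear.
move=> mQ mC s1 s2 v0 v1 v2 G u1 u2 u3 u4 u5 u6 u7 u8 u9 u10 u11 u12 u13.
move=> n1 n2 n3 n4 n5 n6 n7 n8 n9 n10 n11 n12 n13 h1 h2 hQ hC h0.
(* The closed form shows that [v0], the [vdm] of the upper dents of the cored hexagon, is nonzero;
   so the count [mC] determines the common sum [G]. *)
have e0 : v0 = u13 * u2 * (u5 * u3) / (u4 * u1) by rewrite -h0; field; apply/andP.
have v0n : v0 != 0 by rewrite e0 !(mulf_neq0, invr_neq0).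
have eG : G = mC * u7 * u6 / (v0 * u12) by rewrite hC; field; apply/andP.
have eQ : mQ = v1 * v2 * G / (u8 * u9) by rewrite -hQ; field; apply/andP.
rewrite eQ eG e0 -h1 -h2; field.
by do ?[apply/andP; split].
Qed.
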